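(* For any $0<\epsilon<1-\frac{1}{\sqrt 2}$, there exist $\hat{P}\in\mathbb{N}$, $\nu_1,\nu_2$ with $0<\nu_1<\frac12\nu_2<\nu_2<1$, and $c_1>c_2>0$ such that the following holds. Fix any integer $p\ge\hat P$ and let $\mathcal{S}(\epsilon)=\{\boldsymbol{\sigma}\in\Sigma_n:H(\boldsymbol{\sigma})\ge(1-\epsilon)\sqrt{2\ln 2}\}$, where $H$ is the Ising pure $p$-spin Hamiltonian. (a) The set $\mathcal{S}(\epsilon)$ exhibits the $(\nu_1,\nu_2)$-OGP with probability at least $1-e^{-\Theta(n)}$ as $n\to\infty$. (b) Let $\mathcal{C}_1,\dots,\mathcal{C}_L$ be the (unique) $(\nu_1,\nu_2)$-clustering of $\mathcal{S}(\epsilon)$. Then, with probability at least $1-e^{-\Theta(n)}$ as $n\to\infty$, $|\mathcal{S}(\epsilon)|\ge 2^{c_1n}$ and $\max_{1\le i\le L}|\mathcal{C}_i|\le 2^{c_2n}$. In particular, $L=2^{\Omega(n)}$. Furthermore, the same holds for the set $\mathcal{S}(\epsilon)\setminus\mathcal{S}(\epsilon')$ in place of $\mathcal{S}(\epsilon)$, where $0<\epsilon'<\epsilon<1-\frac{1}{\sqrt 2}$ are arbitrary (and $\mathcal{S}(\epsilon')$ is defined as $\mathcal{S}(\epsilon)$ with $\epsilon'$ replacing $\epsilon$).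
   Context: For $n\in\mathbb{N}$, $\Sigma_n=\{-1,1\}^n$ and $d_H$ is the Hamming distance on $\Sigma_n$. For a fixed integer $p\ge 2$, the Ising pure $p$-spin Hamiltonian is $$H(\boldsymbol{\sigma})=n^{-\frac{p+1}{2}}\sum_{1\le i_1,\dots,i_p\le n}J_{i_1,\dots,i_p}\boldsymbol{\sigma}_{i_1}\cdots\boldsymbol{\sigma}_{i_p},\qquad \boldsymbol{\sigma}\in\Sigma_n,$$ where $(J_{i_1,\dots,i_p})_{1\le i_1,\dots,i_p\le n}$ are i.i.d. standard normal; probabilities are with respect to these. $(\nu_1,\nu_2)$-OGP (Overlap Gap Property): for $0<\nu_1<\nu_2<1$, a set $A\subset\Sigma_n$ exhibits the $(\nu_1,\nu_2)$-OGP if for any $\boldsymbol{\sigma}_1,\boldsymbol{\sigma}_2\in A$, either $d_H(\boldsymbol{\sigma}_1,\boldsymbol{\sigma}_2)\le\nu_1n$ or $d_H(\boldsymbol{\sigma}_1,\boldsymbol{\sigma}_2)\ge\nu_2n$. $(\nu_1,\nu_2)$-clustering: a collection $(\mathcal{C}_\ell)_{\ell=1}^L$ of subsets of $A\subseteq\Sigma_n$ is a $(\nu_1,\nu_2)$-clustering of $A$ if it is a partition of $A$ (into nonempty sets) such that (i) for any $1\le i\le L$ and $\boldsymbol{\sigma},\boldsymbol{\sigma}'\in\mathcal{C}_i$, $d_H(\boldsymbol{\sigma},\boldsymbol{\sigma}')\le\nu_1n$; (ii) for any $1\le i<j\le L$, $\boldsymbol{\sigma}\in\mathcal{C}_i$,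 $\boldsymbol{\sigma}'\in\mathcal{C}_j$, $d_H(\boldsymbol{\sigma},\boldsymbol{\sigma}')\ge\nu_2n$. It is known that if $A$ exhibits the $(\nu_1,\nu_2)$-OGP with $0<\nu_1<\frac12\nu_2<\frac12$, then $A$ has a unique $(\nu_1,\nu_2)$-clustering; thus the clustering in (b) is well defined on the event in (a). ''With probability at least $1-e^{-\Theta(n)}$ as $n\to\infty$'' means: there is a constant $C>0$ not depending on $n$ such that the probability is at least $1-e^{-Cn}$ for all large $n$. $L=2^{\Omega(n)}$ means $L\ge 2^{Cn}$ for some constant $C>0$ not depending on $n$ and all large $n$, on the event in (b). $|A|$ denotes cardinality. *)

(* Defs.v *)
From HB Require Import structures.
From mathcomp Require Import all_boot all_order all_algebra.
From mathcomp Require Import all_classical all_reals all_analysis.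

Set Implicit Arguments.
Unset Strict Implicit.
Unset Printing Implicit Defensive.

Import Order.TTheory GRing.Theory Num.Theory.
Import numFieldNormedType.Exports.

Local Open Scope classical_set_scope.
Local Open Scope ring_scope.

(* The hypercube {-1,1}^n: the boolean [true] encodes +1 and [false]
   encodes -1. *)
Definition cube (n : nat) : finType := {ffun 'I_n -> bool}.

Definition spin (R : realType) (n : nat) (s : cube n) (i : 'I_n) : R :=
  if s i then 1 else -1.

Definition hamming (n : nat) (s t : cube n) : nat := #|[pred i | s i != t i]|.

(* Mutual independence: the product rule for every finite subfamily. *)
Definition mutually_independent (R : realType) (d : measure_display)
    (T : measurableType d) (P : probability T R) (I : finType)
    (X : I -> {RV P >-> R}) : Prop :=
  forall (K : {set I}) (B : I -> set R),
    (forall i, measurable (B i)) ->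
    P [set w | forall i, i \in K -> B i (X i w)] =
      (\prod_(i in K) P (X i @^-1` B i))%E.

Definition iid_standard_normal (R : realType) (d : measure_display)
    (T : measurableType d) (P : probability T R) (I : finType)
    (X : I -> {RV P >-> R}) : Prop :=
  mutually_independent X /\
  forall (i : I) (B : set R), measurable B ->
    distribution P (X i) B = normal_prob 0 1 B.

(* An index (i_1, ..., i_p) in {1..n}^p is a function 'I_p -> 'I_n. *)
Definition hamiltonian (R : realType) (p n : nat)
    (J : {ffun 'I_p -> 'I_n} -> R) (s : cube n) : R :=
  n%:R `^ (- (p.+1%:R / 2)) *
  \sum_(i : {ffun 'I_p -> 'I_n}) J i * \prod_(k < p) spin R s (i k).

Definition superlevel (R : realType) (p n : nat)
    (J : {ffun 'I_p -> 'I_n} -> R) (eps : R) : {set cube n} :=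
  finset (fun s : cube n =>
    (1 - eps) * Num.sqrt (2 * ln 2) <= hamiltonian J s).

Definition OGP (R : realType) (nu1 nu2 : R) (n : nat) (A : {set cube n}) :
    Prop :=
  forall s t, s \in A -> t \in A ->
    (hamming s t)%:R <= nu1 * n%:R \/ nu2 * n%:R <= (hamming s t)%:R.

(* Clusterings are unordered: [finset.partition] provides nonempty, pairwise
   disjoint blocks covering A, and the number L of clusters is [#|Cl|]. *)
Definition clustering (R : realType) (nu1 nu2 : R) (n : nat)
    (A : {set cube n}) (Cl : {set {set cube n}}) : Prop :=
  [/\ finset.partition Cl A,
      forall C s t, C \in Cl -> s \in C -> t \in C ->
        (hamming s t)%:R <= nu1 * n%:R
    & forall C D s t, C \in Cl -> D \in Cl -> C != D ->
        s \in C -> t \in D -> nu2 * n%:R <= (hamming s t)%:R].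

Definition shattered (R : realType) (nu1 nu2 c1 c2 : R) (n : nat)
    (A : {set cube n}) (Cl : {set {set cube n}}) : Prop :=
  [/\ unique (clustering nu1 nu2 A) Cl,
      2 `^ (c1 * n%:R) <= #|A|%:R
    & (\max_(C in Cl) #|C|)%:R <= (2 `^ (c2 * n%:R) : R)].

(* The sequence [q] of probabilities is at least 1 - e^{-Theta(n)}. *)
Definition exp_whp (R : realType) (q : nat -> \bar R) : Prop :=
  exists2 C : R, 0 < C &
    \forall n \near \oo, ((1 - expR (- (C * n%:R)))%:E <= q n)%E.

(* Parts (a) and (b) for a random set A, followed by L = 2^{Omega(n)}, which
   holds everywhere on the event of (b). *)
Definition shattering (R : realType) (nu1 nu2 c1 c2 : R)
    (d : nat -> measure_display) (T : forall n, measurableType (d n))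
    (P : forall n, probability (T n) R)
    (A : forall n, T n -> {set cube n}) : Prop :=
  [/\ exp_whp (fun n => P n [set w | OGP nu1 nu2 (A n w)]),
      exp_whp (fun n =>
        P n [set w | exists Cl, shattered nu1 nu2 c1 c2 (A n w) Cl])
    & exists2 C : R, 0 < C &
        \forall n \near \oo, forall w Cl,
          shattered nu1 nu2 c1 c2 (A n w) Cl -> 2 `^ (C * n%:R) <= #|Cl|%:R].

(* Main.v *)
Require Import Defs.
From HB Require Import structures.
From mathcomp Require Import all_boot all_order all_algebra.
From mathcomp Require Import all_classical all_reals all_analysis.
From mathcomp Require Import measurable_realfun ring lra.

(** Write [x = 1 - eps], so that [1 / 2 < x ^+ 2 < 1], and let [h = x * s] with
    [s = Num.sqrt (2 * ln 2)]. The energies are centered Gaussian variables of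
    variance [1 / n], and those of two configurations of overlap [r] have
    correlation [r ^+ p]. A given configuration has energy at least [h] with
    probability about [2 ^ (- x ^+ 2 * n)], so the level set has about
    [2 ^ ((1 - x ^+ 2) * n)] points.

    Overlap gap. If [p] is large, then [r ^+ p] is tiny as soon as [r] is bounded
    away from 1 and -1, and two such configurations both exceed [h] with probability
    about [2 ^ (- 2 * x ^+ 2 * n)]. There are about [2 ^ n] times [expR (k * n)]
    pairs at distance at most [nu2 * n], with [k] small if [nu2] is small. As
    [2 * x ^+ 2 > 1], no pair has a distance strictly between [nu1 * n] and
    [nu2 * n], outside an event of exponentially small probability
    ([not_OGP_prob]). This gives a unique clustering ([OGP_clustering]), whose
    clusters lie in balls of radius [nu1 * n] and so have at most [2 ^ (c2 * n)]
    points ([cluster_card_le]).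

    Abundance. For large [p] the second moment of the size of the level set is at
    most [n.+1] times what it would be for independent energies
    ([card_level_set_second_moment]): pairs of moderate overlap are too weakly
    correlated, and pairs of overlap near 1 or -1 too few, to matter. With a
    lower bound on the first moment, of an exponential rate as close to the true
    one as desired ([ham_lower]), Paley--Zygmund shows that the
    level set slightly above [h] is as large as expected with probability at
    least [expR (- d * n)], where [d] is as small as desired. A set of couplings
    of such a probability has an l1 neighbourhood of overwhelming probability
    ([gauss_isoperimetry]), and moving within this neighbourhood lowers the
    energies only slightly; so the level set at [h] is as large as expected,
    outside an event of exponentially small probability
    ([level_set_lower_tail]). The concentration inequality is proved by
    integrating out the couplings one at a time ([lipschitz_exp_moments]); since
    all couplings have coefficients of the same size, controlling each coordinate
    separately gives the right order.

    Removing the configurations above a strictly higher level only removes an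
    exponentially small fraction, by Markov's inequality, so that the difference of
    two level sets is treated at the same time ([good_level_sets]). The number of
    clusters is at least the size of the set divided by the largest cluster. *)

Set Implicit Arguments.
Unset Strict Implicit.
Unset Printing Implicit Defensive.

Import Order.TTheory GRing.Theory Num.Theory.
Import numFieldNormedType.Exports.

Local Open Scope classical_set_scope.
Local Open Scope ring_scope.

(** * Product sigma-algebra on R^I and Lipschitz functions *)

Lemma measurable_fun_bigsum d (T : measurableType d) (R : realType) (I : Type)
    (s : seq I) (f : I -> T -> R) :
  (forall i, measurable_fun setT (f i)) ->
  measurable_fun setT (fun x => \sum_(i <- s) f i x).
Proof.
move=> mf; elim: s => [|i s IH].
  by under eq_fun do rewrite big_nil; exact: measurable_cst.
by under eq_fun do rewrite big_cons; exact: measurable_funD.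
Qed.

Section cylinders.
Variables (R : realType) (I : finType).

(** The measurable boxes: products over [I] of Borel sets of [R]. They form a
    pi-system, so two probabilities that agree on them are equal. *)
Definition cylinder : set (set (I -> R)) :=
  [set A | exists2 B : I -> set R, (forall i, measurable (B i)) &
     A = [set y | forall i, B i (y i)]].

(** Real vectors indexed by [I], as plain functions, with the product
    sigma-algebra, generated by the boxes. *)
Definition rvect : measurableType (cylinder.-sigma) := g_sigma_algebraType cylinder.

Lemma cylinderI : setI_closed cylinder.
Proof.
move=> _ _ [B mB ->] [C mC ->]; exists (fun i => B i `&` C i).
  by move=> i; exact: measurableI.
apply/seteqP; split => y /= => [[yB yC] i|yBC]; first by split.
by split => i; have [] := yBC i.
Qed.

Lemma measurable_cylinder (B : I -> set R) : (forall i, measurable (B i)) ->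
  measurable ([set y | forall i, B i (y i)] : set rvect).
Proof. by move=> mB; apply: sub_sigma_algebra; exists B. Qed.

Lemma measurable_coord (i : I) : measurable_fun setT (fun y : rvect => y i : R).
Proof.
move=> _ A mA; rewrite setTI.
rewrite [X in measurable X](_ : _ =
    [set y | forall j, (if j == i then A else setT) (y j)]).
  apply: (measurable_cylinder (B := fun j => if j == i then A else setT)).
  by move=> j; case: ifP.
apply/seteqP; split => y /= => [yA j|/(_ i)]; last by rewrite eqxx.
by case: eqP => // ->.
Qed.

Lemma measurable_rvectP d (T : measurableType d) (f : T -> rvect) :
  (forall i, measurable_fun setT (fun t => f t i)) -> measurable_fun setT f.
Proof.
move=> mf; apply: (measurability (cylinder : set (set rvect)) (erefl _)) => _ [_ [B mB ->] <-].
rewrite setTI [X in measurable X](_ : _ =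
    \big[setI/setT]_(i <- index_enum I) ((fun t => f t i) @^-1` B i)).
  by apply: bigsetI_measurable => i _; rewrite -[_ @^-1` _]setTI; exact: mf.
apply/seteqP; split => t /=.
  by move=> tB; rewrite -bigcap_seq => i /= _; exact: tB.
by rewrite -bigcap_seq => + i => /(_ i); apply; rewrite /= mem_index_enum.
Qed.

(** The l1 distance. All coordinates of a Hamiltonian carry weights of the same
    absolute value, so that l1 estimates lose nothing below. *)
Definition l1dist (x y : I -> R) : R := \sum_i `|x i - y i|.

Lemma l1distC x y : l1dist x y = l1dist y x.
Proof. by apply: eq_bigr => i _; rewrite distrC. Qed.

(** The vector [y] with coordinate [k] replaced by [x]. *)
Definition upd (k : I) (x : R) (y : I -> R) : I -> R :=
  fun i => if i == k then x else y i.

Lemma measurable_upd (k : I) :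
  measurable_fun setT (fun z : R * rvect => upd k z.1 z.2 : rvect).
Proof.
apply: measurable_rvectP => i; rewrite /upd; case: eqP => _; first exact: measurable_fst.
exact: measurableT_comp (measurable_coord i) measurable_snd.
Qed.

(** [F] is [L]-Lipschitz for the l1 distance; one inequality suffices because
    [x] and [y] may be exchanged. *)
Definition lipschitz_l1 (L : R) (F : (I -> R) -> R) :=
  forall x y, F x - F y <= L * l1dist x y.

(** Being Lipschitz, [F] is the supremum of the countably many measurable
    functions [y |-> F q - L * l1dist y q], for rational vectors [q]. *)
Lemma measurable_lipschitz_l1 (L : R) (F : (I -> R) -> R) :
  0 <= L -> lipschitz_l1 L F -> measurable_fun setT (F : rvect -> R).
Proof.
move=> L0 lipF.
apply: (measurability _ (RGenOInfty.measurableE R)) => _ [_ [a ->] <-].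
rewrite setTI preimage_itvoy.
pose pt (q : {ffun I -> rat}) : I -> R := fun i => ratr (q i).
pose D (q : {ffun I -> rat}) : set rvect := [set y | a + L * l1dist y (pt q) < F (pt q)].
have mD q : measurable (D q).
  rewrite /D -preimage_itvNyo -[_ @^-1` _]setTI.
  have mf : measurable_fun setT (fun y : rvect => a + L * l1dist y (pt q)).
    apply: measurable_funD => //; apply: measurable_funM => //.
    apply: measurable_fun_bigsum => i; apply: measurableT_comp => //.
    by apply: measurable_funB => //; exact: measurable_coord.
  exact: mf.
rewrite (_ : [set y | _] = \bigcup_q D q).
  by apply: countable_bigcupT_measurable => //; exact: countableP.
apply/seteqP; split => y /=; last first.
  by case=> q _; rewrite /D /=; have := lipF (pt q) y; rewrite l1distC; lra.
(* A rational point within F y - a of y, up to the Lipschitz constant. *)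
move=> ay; pose e := F y - a.
have e0 : 0 < e by rewrite /e; lra.
have den : 0 < 2 * L * #|I|%:R + 1.
  by rewrite ltr_wpDl // mulr_ge0 // mulr_ge0.
pose dl := e / (2 * L * #|I|%:R + 1).
have dl0 : 0 < dl by rewrite divr_gt0.
have near_rat (i : I) : exists r : rat, `|y i - ratr r| <= dl.
  have lt_dl : y i - dl < y i + dl by lra.
  have [r] := rat_in_itvoo lt_dl; rewrite in_itv /= => /andP[h1 h2]; exists r.
  by rewrite ler_norml; apply/andP; split; lra.
exists [ffun i => xchoose (near_rat i)] => //; rewrite /D /=.
set q := finfun _.
have hd : 2 * L * l1dist y (pt q) < e.
  apply: (@le_lt_trans _ _ (2 * L * (#|I|%:R * dl))).
    rewrite ler_wpM2l ?mulr_ge0 // mulr_natl -sumr_const; apply: ler_sum => i _.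
    by rewrite /pt ffunE; exact: (xchooseP (near_rat i)).
  by rewrite /dl !mulrA ltr_pdivrMr // [ltRHS]mulrDr mulr1 [_ * e]mulrC ltrDl.
have := lipF y (pt q); rewrite /e in hd; lra.
Qed.

End cylinders.

(** * Vectors of independent standard normal variables *)

Section iid_gauss.
Variables (R : realType) (I : finType).
Local Notation rvect := (rvect R I).
Local Notation gauss := (normal_prob (0 : R) 1).

(** [mu] is the law of independent standard normal coordinates: the mass of a box
    is the product of the normal masses of its sides. *)
Definition iid_gauss (mu : probability rvect R) : Prop :=
  forall B : I -> set R, (forall i, measurable (B i)) ->
    mu [set y | forall i, B i (y i)] = (\prod_i gauss (B i))%E.

Lemma measurable_resample (k : I) (G : rvect -> \bar R) :
  measurable_fun setT G -> (forall y, 0 <= G y)%E ->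
  measurable_fun setT (fun y : rvect => \int[gauss]_x G (upd k x y))%E.
Proof.
move=> mG G0.
pose phi (z : R * rvect) : rvect := upd k z.1 z.2.
have mGphi : measurable_fun setT (G \o phi).
  by apply: measurableT_comp => //; exact: measurable_upd.
exact: (@measurable_fun_fubini_tonelli_G _ _ _ _ R gauss (G \o phi) mGphi (fun z => G0 _)).
Qed.

Variable mu : probability rvect R.
Hypothesis mu_gauss : iid_gauss mu.

(** Replacing one coordinate by an independent standard normal one does not
    change the law: both laws agree on boxes. *)
Lemma integral_resample (k : I) (G : rvect -> \bar R) :
  measurable_fun setT G -> (forall y, 0 <= G y)%E ->
  (\int[mu]_y G y = \int[mu]_y \int[gauss]_x G (upd k x y))%E.
Proof.
move=> mG G0.
pose phi (z : R * rvect) : rvect := upd k z.1 z.2.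
have mphi : measurable_fun setT phi by exact: measurable_upd.
pose nu_of : {measure set rvect -> \bar R} := pushforward (gauss \x mu)%E phi.
pose nu := nu_of mphi.
have nuE A : measurable A -> mu A = nu A.
  move=> mA; apply: (@measure_unique _ R rvect (@cylinder R I) (fun=> setT) (erefl _)
    (@cylinderI R I) _ _ mu nu _ _ A mA).
  - by move=> _; exists (fun=> setT) => //; apply/seteqP; split.
  - by apply/seteqP; split => // y _; exists 0%N.
  - move=> _ [B mB ->].
    pose C i := if i == k then setT else B i.
    have mC i : measurable (C i) by rewrite /C; case: ifP.
    transitivity ((gauss \x mu)%E (B k `*` [set y | forall i, C i (y i)])).
      rewrite product_measure1E; [|exact: mB|exact: (measurable_cylinder mC)].
      rewrite [LHS](mu_gauss mB) [X in (_ * X)%E](mu_gauss mC).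
      have -> : (\prod_i gauss (C i) = \prod_(i | i != k) gauss (B i))%E.
        rewrite (bigD1 k) //= {1}/C eqxx.
        rewrite -[[set: R]]/(@setT (measurableTypeR R)) probability_setT mul1e.
        by apply: eq_bigr => i /negbTE ik; rewrite /C ik.
      by rewrite (bigD1 k).
    rewrite (_ : _ `*` _ = phi @^-1` [set y | forall i, B i (y i)]) //.
    apply/seteqP; split => -[x y] /=.
      case=> xk h i; rewrite /phi /upd /=; case: eqP => [->//|/eqP/negbTE ik].
      by have := h i; rewrite /C ik.
    move=> h; split; first by have := h k; rewrite /phi /upd eqxx.
    move=> i; rewrite /C; case: eqP => // /eqP/negbTE ik.
    by have := h i; rewrite /phi /upd ik.
  - by move=> _; apply: (@le_lt_trans _ _ 1%E); [exact: probability_le1|exact: ltry].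
rewrite (eq_measure_integral nu); last by move=> A mA _; exact: nuE.
rewrite ge0_integral_pushforward //.
rewrite preimage_setT.
have mGphi : measurable_fun setT (G \o phi) by exact: measurableT_comp.
exact: (@fubini_tonelli2 _ _ _ _ R gauss mu (G \o phi) mGphi (fun z => G0 _)).
Qed.

End iid_gauss.

(** * Exponential moments in one dimension *)

Section gauss_mgf.
Variable R : realType.
Local Notation gauss := (normal_prob (0 : R) 1).
Local Notation leb := (@lebesgue_measure R).

Lemma ge0_integral_normal_prob (m s : R) (f : R -> \bar R) :
  measurable_fun setT f -> (forall x, 0 <= f x)%E ->
  (\int[normal_prob m s]_x f x = \int[leb]_x (f x * (normal_pdf m s x)%:E))%E.
Proof.
move=> mf f0; have dom := normal_prob_dominates m s.
rewrite -(Radon_Nikodym_SigmaFinite.change_of_variables dom) //.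
have iR := Radon_Nikodym_SigmaFinite.f_integrable dom.
have mR := measurable_int _ iR.
apply: ae_eq_integral => //.
- exact: emeasurable_funM.
- apply: emeasurable_funM => //.
  by apply/measurable_EFinP; exact: measurable_normal_pdf.
apply: ae_eqe_mul2l; apply: integral_ae_eq => //.
- by apply/measurable_EFinP; exact: measurable_normal_pdf.
- by move=> E _ mE; rewrite -Radon_Nikodym_SigmaFinite.f_integral.
Qed.

Lemma integral_gauss_expR (a : R) :
  (\int[gauss]_x (expR (a * x))%:E = (expR (a ^+ 2 / 2))%:E)%E.
Proof.
rewrite ge0_integral_normal_prob; last 2 first.
- by apply/measurable_EFinP; apply: measurableT_comp.
- by move=> x; rewrite lee_fin expR_ge0.
transitivity (\int[leb]_x ((expR (a ^+ 2 / 2))%:E * (normal_pdf a 1 x)%:E))%E.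
  apply: eq_integral => x _; rewrite -!EFinM !normal_pdfE ?oner_eq0 //.
  rewrite /normal_fun mulrCA -expRD [in RHS]mulrCA -expRD.
  by congr (_ * expR _)%:E; field.
rewrite ge0_integralZl ?lee_fin ?expR_ge0 //.
- by rewrite integral_normal_pdf mule1.
- by apply/measurable_EFinP; exact: measurable_normal_pdf.
- by move=> x _; rewrite lee_fin normal_pdf_ge0.
Qed.

End gauss_mgf.

Section ge0_integral_tools.
Variables (R : realType) (d : measure_display) (T : measurableType d).
Variable mu : {measure set T -> \bar R}.

Lemma ge0_integral_lin2 (f g : T -> R) (a b : R) :
  measurable_fun setT f -> measurable_fun setT g ->
  (forall x, 0 <= f x) -> (forall x, 0 <= g x) -> 0 <= a -> 0 <= b ->
  (\int[mu]_x (a * f x + b * g x)%:E =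
   a%:E * \int[mu]_x (f x)%:E + b%:E * \int[mu]_x (g x)%:E)%E.
Proof.
move=> mf mg f0 g0 a0 b0.
under eq_integral do rewrite EFinD !EFinM.
rewrite ge0_integralD //=; last 4 first.
- by move=> x _; rewrite -EFinM lee_fin mulr_ge0.
- by apply/measurable_EFinP; apply: measurable_funM.
- by move=> x _; rewrite -EFinM lee_fin mulr_ge0.
- by apply/measurable_EFinP; apply: measurable_funM.
rewrite !ge0_integralZl ?lee_fin //.
- by apply/measurable_EFinP.
- by move=> x _; rewrite lee_fin.
- by apply/measurable_EFinP.
- by move=> x _; rewrite lee_fin.
Qed.

Lemma ge0_integral_mono (f g : T -> R) :
  measurable_fun setT f -> measurable_fun setT g ->
  (forall x, 0 <= f x) -> (forall x, f x <= g x) ->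
  (\int[mu]_x (f x)%:E <= \int[mu]_x (g x)%:E)%E.
Proof.
move=> mf mg f0 fg; apply: ge0_le_integral => //.
- by move=> x _; rewrite lee_fin.
- by apply/measurable_EFinP.
- by apply/measurable_EFinP.
- by move=> x _; rewrite lee_fin.
Qed.

Lemma markov_ge0 (f : T -> R) (c : R) (A : set T) :
  measurable_fun setT f -> measurable A -> (forall x, 0 <= f x) -> 0 <= c ->
  (forall x, A x -> c <= f x) ->
  (c%:E * mu A <= \int[mu]_x (f x)%:E)%E.
Proof.
move=> mf mA f0 c0 cf.
have -> : (c%:E * mu A = \int[mu]_x (c * \1_A x)%:E)%E.
  under eq_integral do rewrite EFinM.
  rewrite ge0_integralZl ?lee_fin //; first by rewrite integral_indic // setIT.
  by apply/measurable_EFinP; exact: measurable_indic.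
apply: ge0_integral_mono => //.
- by apply: measurable_funM => //; exact: measurable_indic.
- by move=> x; rewrite mulr_ge0.
- move=> x; rewrite indicE; case: (boolP (x \in A)) => [|_].
    by rewrite inE mulr1 => /cf.
  by rewrite mulr0.
Qed.

End ge0_integral_tools.

Section expR_extra.
Variable R : realType.

Lemma expR_lip_abs (c x : R) : 0 <= c -> expR (c * `|x|) <= expR (c * x) + expR (- c * x).
Proof.
move=> c0; case: (ger0P x) => _.
  by rewrite lerDl expR_ge0.
by rewrite mulrN mulNr lerDr expR_ge0.
Qed.

Lemma expR_cosh_le (u v : R) : `|u| <= `|v| ->
  expR u + expR (- u) <= expR v + expR (- v).
Proof.
move=> uv.
wlog v0 : v uv / 0 <= v.
  move=> H; case: (lerP 0 v) => [/H->//|v0].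
  rewrite [leRHS]addrC -{2}[v]opprK; apply: H; last by rewrite oppr_ge0 ltW.
  by rewrite normrN.
rewrite (ger0_norm v0) ler_norml in uv; have {uv}/andP[uv1 uv2] := uv.
have h1 : expR u <= expR v by rewrite ler_expR.
have h2 : expR (- u - v) <= 1 by rewrite expR_le1; lra.
have e1 : expR (- v) = expR u * expR (- u - v) by rewrite -expRD; congr expR; ring.
have e2 : expR (- u) = expR v * expR (- u - v) by rewrite -expRD; congr expR; ring.
rewrite e1 e2; nra.
Qed.

End expR_extra.

Section gauss_lipschitz1.
Variable R : realType.
Local Notation gauss := (normal_prob (0 : R) 1).

(** The one-dimensional concentration inequality. For an independent copy [y] of
    [x], symmetry bounds the mean of [expR (f x - f y)] by that of
    [cosh (L * (x - y))], which is [expR (L ^+ 2)]. *)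
Lemma gauss_lipschitz (f : R -> R) (L : R) : 0 <= L ->
  measurable_fun setT f -> (forall x y, f x - f y <= L * `|x - y|) ->
  exists a b : R, [/\ (\int[gauss]_x (expR (f x))%:E = a%:E)%E,
    (\int[gauss]_x (expR (- f x))%:E = b%:E)%E, 0 < a & a * b <= expR (L ^+ 2)].
Proof.
move=> L0 mf lipf.
set m := expR (L ^+ 2 / 2).
have mE (g : R -> R) : measurable_fun setT g -> measurable_fun setT (fun x : R => expR (g x)).
  by move=> mg; apply: measurableT_comp.
have mlin (c : R) : measurable_fun setT (fun x : R => c * x).
  exact: mulrl_measurable.
have mlin2 (u v : R) (g h : R -> R) : measurable_fun setT g -> measurable_fun setT h ->
    measurable_fun setT (fun x : R => u * expR (g x) + v * expR (h x)).
  by move=> mg mh; apply: measurable_funD; apply: measurable_funM => //; exact: mE.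
have lin2 (u v : R) (g h : R -> R) : 0 <= u -> 0 <= v ->
    measurable_fun setT g -> measurable_fun setT h ->
    (\int[gauss]_x (u * expR (g x) + v * expR (h x))%:E =
     u%:E * \int[gauss]_x (expR (g x))%:E + v%:E * \int[gauss]_x (expR (h x))%:E)%E.
  move=> u0 v0 mg mh; apply: ge0_integral_lin2 => //.
  - exact: mE.
  - exact: mE.
have EL : (\int[gauss]_x (expR (L * x))%:E = m%:E)%E by exact: integral_gauss_expR.
have ENL : (\int[gauss]_x (expR (- L * x))%:E = m%:E)%E.
  by rewrite integral_gauss_expR sqrrN.
have fin (g : R -> R) : measurable_fun setT g -> (forall x y, g x - g y <= L * `|x - y|) ->
    exists2 a : R, 0 <= a & (\int[gauss]_x (expR (g x))%:E = a%:E)%E.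
  move=> mg lipg.
  have le : (\int[gauss]_x (expR (g x))%:E <= (expR (g 0) * m + expR (g 0) * m)%:E)%E.
    apply: (@le_trans _ _ (\int[gauss]_x
        (expR (g 0) * expR (L * x) + expR (g 0) * expR (- L * x))%:E)%E).
      apply: ge0_integral_mono; [exact: mE| |by move=> x; exact: expR_ge0|].
        exact: mlin2.
      move=> x; rewrite -mulrDr; apply: (@le_trans _ _ (expR (g 0) * expR (L * `|x|))).
        rewrite -expRD ler_expR; have := lipg x 0; rewrite subr0; lra.
      by rewrite ler_wpM2l ?expR_ge0 // expR_lip_abs.
    rewrite lin2 ?expR_ge0 //.
    by rewrite EL ENL.
  have ge : (0 <= \int[gauss]_x (expR (g x))%:E)%E.
    by apply: integral_ge0 => x _; rewrite lee_fin expR_ge0.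
  exists (fine (\int[gauss]_x (expR (g x))%:E)%E); first exact: fine_ge0.
  rewrite fineK // ge0_fin_numE //; apply: le_lt_trans le _; exact: ltry.
have mNf : measurable_fun setT (fun x => - f x) by apply: measurableT_comp.
have [a a0 aE] := fin f mf lipf.
have [b b0 bE] : exists2 b : R, 0 <= b & (\int[gauss]_x (expR (- f x))%:E = b%:E)%E.
  by apply: fin => // x y; rewrite distrC; have := lipf y x; lra.
exists a, b; split => //.
- rewrite lt_neqAle a0 andbT eq_sym; apply/eqP => a_eq0.
  (* Integrating 2 t <= e^f + t^2 e^(-f) bounds a from below. *)
  pose t : R := (b + 1)^-1.
  have t0 : 0 < t by rewrite invr_gt0; lra.
  have : ((2 * t)%:E <= a%:E + (t ^+ 2)%:E * b%:E)%E.
    rewrite -aE -bE -[X in (X + _)%E]mul1e -lin2 ?sqr_ge0 //.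
    rewrite -[leLHS]mule1 -(@probability_setT _ _ _ gauss).
    apply: markov_ge0 => //.
    + exact: mlin2.
    + by move=> x; apply: addr_ge0; apply: mulr_ge0; rewrite ?expR_ge0 ?sqr_ge0.
    + by rewrite mulr_ge0 // ltW.
    + move=> x _; rewrite mul1r.
      rewrite expRN -subr_ge0.
      have -> : expR (f x) + t ^+ 2 / expR (f x) - 2 * t = (expR (f x) - t) ^+ 2 / expR (f x).
        by field; rewrite gt_eqF ?expR_gt0.
      by rewrite divr_ge0 ?sqr_ge0 ?expR_ge0.
  rewrite -EFinM -EFinD lee_fin a_eq0 add0r expr2 -mulrA.
  rewrite [2 * t]mulrC ler_pM2l // => h.
  have : t * b <= 1 by rewrite /t mulrC ler_pdivrMr; lra.
  lra.
- have : ((2 * (a * b))%:E <= (2 * expR (L ^+ 2))%:E)%E.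
    have -> : (2 * (a * b))%:E = (\int[gauss]_x (b * expR (f x) + a * expR (- f x))%:E)%E.
      rewrite lin2 //.
      by rewrite aE bE -!EFinM -EFinD; congr EFin; ring.
    have -> : (2 * expR (L ^+ 2))%:E = (\int[gauss]_x (m * expR (L * x) + m * expR (- L * x))%:E)%E.
      rewrite lin2 ?expR_ge0 //.
      rewrite EL ENL -!EFinM -EFinD /m -expRD; congr EFin.
      have -> : L ^+ 2 / 2 + L ^+ 2 / 2 = L ^+ 2 by field.
      ring.
    apply: ge0_integral_mono.
    + exact: mlin2.
    + exact: mlin2.
    + by move=> x; apply: addr_ge0; apply: mulr_ge0; rewrite ?expR_ge0.
    + move=> x; rewrite -lee_fin.
      have -> : (b * expR (f x) + a * expR (- f x))%:E =
          (\int[gauss]_y (expR (f x) * expR (- f y) + expR (- f x) * expR (f y))%:E)%E.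
        rewrite lin2 ?expR_ge0 //.
        by rewrite aE bE -!EFinM -EFinD; congr EFin; ring.
      have -> : (m * expR (L * x) + m * expR (- L * x))%:E =
          (\int[gauss]_y (expR (L * x) * expR (- L * y) + expR (- L * x) * expR (L * y))%:E)%E.
        rewrite lin2 ?expR_ge0 //.
        by rewrite EL ENL -!EFinM -EFinD; congr EFin; ring.
      apply: ge0_integral_mono.
      * exact: mlin2.
      * exact: mlin2.
      * by move=> y; apply: addr_ge0; apply: mulr_ge0; rewrite ?expR_ge0.
      * move=> y; rewrite -!expRD.
        have -> : - f x + f y = - (f x - f y) by ring.
        have -> : L * x + - L * y = L * (x - y) by ring.
        have -> : - L * x + L * y = - (L * (x - y)) by ring.
        apply: expR_cosh_le; rewrite normrM (ger0_norm L0) ler_norml.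
        by apply/andP; split; [have := lipf y x; rewrite distrC; lra|exact: lipf].
  by rewrite lee_fin ler_pM2l.
Qed.

End gauss_lipschitz1.

(** * Gaussian concentration for l1-Lipschitz functions *)

Section concentration.
Variables (R : realType) (I : finType).
Local Notation rvect := (rvect R I).
Local Notation gauss := (normal_prob (0 : R) 1).
Variable mu : probability rvect R.
Hypothesis mu_gauss : iid_gauss mu.

Lemma measurable_linear_form (s : seq I) (a : I -> R) :
  measurable_fun setT (fun y : rvect => \sum_(i <- s) a i * y i).
Proof.
apply: measurable_fun_bigsum => i; apply: measurable_funM => //.
exact: measurable_coord.
Qed.

(** The moment generating function of a linear form, coordinate by coordinate. *)
Lemma integral_expR_linear (a : I -> R) :
  (\int[mu]_y (expR (\sum_i a i * y i))%:E = (expR (\sum_i a i ^+ 2 / 2))%:E)%E.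
Proof.
have mE s : measurable_fun setT (fun y : rvect => expR (\sum_(i <- s) a i * y i)).
  by apply: measurableT_comp => //; exact: measurable_linear_form.
elim: (index_enum I) (index_enum_uniq I) => [_|k s IH /= /andP[ks us]].
  under eq_integral do rewrite big_nil expR0.
  by rewrite big_nil expR0 integral_cst //= probability_setT mule1.
rewrite (integral_resample mu_gauss k); last 2 first.
- by apply/measurable_EFinP; exact: mE.
- by move=> y; rewrite lee_fin expR_ge0.
transitivity (\int[mu]_y ((expR (a k ^+ 2 / 2))%:E *
    (expR (\sum_(i <- s) a i * y i))%:E))%E.
  apply: eq_integral => y _; rewrite muleC -integral_gauss_expR.
  rewrite -ge0_integralZl ?lee_fin ?expR_ge0 //.
  - apply: eq_integral => x _; rewrite -EFinM -expRD big_cons {1}/upd eqxx.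
    rewrite (_ : \sum_(i <- s) a i * upd k x y i = \sum_(i <- s) a i * y i) 1?addrC //.
    rewrite !big_seq; apply: eq_bigr => i si; rewrite /upd.
    by case: eqP ks => // <-; rewrite si.
  - by apply/measurable_EFinP; apply: measurableT_comp.
rewrite ge0_integralZl ?lee_fin ?expR_ge0 //.
- by rewrite (IH us) -EFinM -expRD big_cons.
- by apply/measurable_EFinP; exact: mE.
Qed.

(** [F y] is determined by the coordinates of [y] listed in [s]. *)
Definition depends_on (s : seq I) (F : (I -> R) -> R) :=
  forall x y, (forall i, i \in s -> x i = y i) -> F x = F y.

Lemma upd_l1dist k x x' (y : I -> R) : l1dist (upd k x y) (upd k x' y) = `|x - x'|.
Proof.
rewrite /l1dist (bigD1 k) //= {1 2}/upd eqxx big1 ?addr0 // => i /negbTE ik.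
by rewrite /upd ik subrr normr0.
Qed.

Lemma upd_l1dist_le k x (y z : I -> R) : l1dist (upd k x y) (upd k x z) <= l1dist y z.
Proof.
apply: ler_sum => i _; rewrite /upd; case: ifP => // _.
by rewrite subrr normr0.
Qed.

(** Tensorization of [gauss_lipschitz]: the coordinates are integrated out one at
    a time, each costing a factor [expR (L ^+ 2)], and the logarithm of the
    partial integral is again [L]-Lipschitz. *)
Lemma lipschitz_exp_moments (L : R) : 0 <= L ->
  forall (s : seq I) (F : (I -> R) -> R), lipschitz_l1 L F -> depends_on s F ->
  (\int[mu]_y (expR (F y))%:E * \int[mu]_y (expR (- F y))%:E <=
   (expR ((size s)%:R * L ^+ 2))%:E)%E.
Proof.
move=> L0; elim => [|k s IH] F lipF depF.
  have E c : (\int[mu]_y (expR (c : R))%:E = (expR c)%:E)%E.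
    by rewrite integral_cst //= probability_setT mule1.
  have Fc y : F y = F (fun=> 0) by apply: depF.
  under eq_integral do rewrite Fc.
  under [X in (_ * X)%E]eq_integral do rewrite Fc.
  by rewrite !E -EFinM -expRD subrr mul0r.
have mF := measurable_lipschitz_l1 L0 lipF.
have mupd y : measurable_fun setT (fun x => upd k x y : rvect).
  apply: measurable_rvectP => i; rewrite /upd; case: (i == k) => //.
have lip1 y x x' : F (upd k x y) - F (upd k x' y) <= L * `|x - x'|.
  by rewrite -(upd_l1dist k x x' y); exact: lipF.
have m1 y : measurable_fun setT (fun x => F (upd k x y)).
  exact: measurableT_comp mF (mupd y).
have mE1 y : measurable_fun setT (fun x => expR (F (upd k x y))).
  exact: measurableT_comp (@measurable_expR R) (m1 y).
have mEE1 y : measurable_fun setT (fun x : R => (expR (F (upd k x y)))%:E).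
  by apply/measurable_EFinP; exact: mE1.
have mE (H : rvect -> R) : measurable_fun setT H ->
    measurable_fun setT (fun y => expR (H y)).
  by move=> mH; exact: measurableT_comp (@measurable_expR R) mH.
have step y := gauss_lipschitz L0 (m1 y) (lip1 y).
have [E EE] : exists E : (I -> R) -> R,
    forall y, (\int[gauss]_x (expR (F (upd k x y)))%:E = (E y)%:E)%E.
  exists (fun y => fine (\int[gauss]_x (expR (F (upd k x y)))%:E)%E) => y.
  by have [a [b [-> _ _ _]]] := step y.
have E0 y : 0 < E y.
  by have [a [b [+ _ a0 _]]] := step y; rewrite EE => -[->].
(* Integrating out coordinate k: e^G is the partial integral of e^F. *)
pose G y := ln (E y).
have GE y : expR (G y) = E y by rewrite /G lnK // posrE.
have lipG : lipschitz_l1 L G.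
  move=> y z; rewrite lerBlDr -ler_expR expRD !GE -lee_fin EFinM.
  rewrite -(EE y) -(EE z).
  rewrite -ge0_integralZl ?lee_fin ?expR_ge0 //; last first.
    exact: mEE1.
  under [leRHS]eq_integral do rewrite -EFinM -expRD.
  apply: ge0_integral_mono.
  - exact: mE1.
  - have mD : measurable_fun setT (fun x => L * l1dist y z + F (upd k x z)).
      exact: measurable_funD (measurable_cst _) (m1 z).
    exact: measurableT_comp (@measurable_expR R) mD.
  - by move=> x; rewrite expR_ge0.
  - move=> x; rewrite ler_expR -lerBlDr (le_trans (lipF _ _)) //.
    by rewrite ler_wpM2l // upd_l1dist_le.
have depG : depends_on s G.
  move=> y z yz; rewrite /G; congr ln; apply: EFin_inj; rewrite -!EE.
  apply: eq_integral => x _; congr (expR _)%:E; apply: depF => i.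
  by rewrite inE /upd; case: eqP => //= _; exact: yz.
have mG := measurable_lipschitz_l1 L0 lipG.
have -> : (\int[mu]_y (expR (F y))%:E = \int[mu]_y (expR (G y))%:E)%E.
  rewrite (integral_resample mu_gauss k).
  - by apply: eq_integral => y _; rewrite EE GE.
  - by apply/measurable_EFinP; exact: mE mF.
  - by move=> y; rewrite lee_fin expR_ge0.
have le2 : (\int[mu]_y (expR (- F y))%:E <= (expR (L ^+ 2))%:E * \int[mu]_y (expR (- G y))%:E)%E.
  have mN (H : rvect -> R) : measurable_fun setT H ->
      measurable_fun setT (fun y => expR (- H y)).
    by move=> mH; apply: (mE (fun y => - H y)); exact: measurableT_comp.
  rewrite (integral_resample mu_gauss k); last 2 first.
  - by apply/measurable_EFinP; apply: mN.
  - by move=> y; rewrite lee_fin expR_ge0.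
  rewrite -ge0_integralZl ?lee_fin ?expR_ge0 //; last first.
    by apply/measurable_EFinP; apply: mN.
  have inner y : exists2 b : R, (\int[gauss]_x (expR (- F (upd k x y)))%:E = b%:E)%E
      & b <= expR (L ^+ 2) * expR (- G y).
    have [a [b [aE bE a0 ab]]] := step y; exists b => //.
    have -> : expR (- G y) = a^-1 by move: aE; rewrite expRN GE EE => -[->].
    by rewrite ler_pdivlMr // mulrC.
  apply: ge0_le_integral => //.
  - by move=> y _; apply: integral_ge0 => x _; rewrite lee_fin expR_ge0.
  - apply: (measurable_resample k (G := fun y => (expR (- F y))%:E)).
      by apply/measurable_EFinP; apply: mN.
    by move=> y; rewrite lee_fin expR_ge0.
  - by apply: emeasurable_funM => //; apply/measurable_EFinP; exact: mN.
  - by move=> y _; have [b -> ?] := inner y; rewrite -EFinM lee_fin.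
apply: (@le_trans _ _ (\int[mu]_y (expR (G y))%:E *
    ((expR (L ^+ 2))%:E * \int[mu]_y (expR (- G y))%:E))%E).
  by rewrite lee_wpmul2l //; apply: integral_ge0 => y _; rewrite lee_fin expR_ge0.
rewrite muleCA [size _]/= mulrS mulrDl mul1r expRD EFinM.
by rewrite lee_wpmul2l ?lee_fin ?expR_ge0 //; exact: IH.
Qed.

Lemma l1dist_triangle (x y z : I -> R) : l1dist x z <= l1dist x y + l1dist y z.
Proof.
rewrite /l1dist -big_split /=; apply: ler_sum => i _.
by rewrite (le_trans _ (ler_normD _ _)) // addrA subrK.
Qed.

(** Two events at l1 distance [u] cannot both be likely. This is
    [lipschitz_exp_moments] for a multiple of the distance to [A]. *)
Lemma gauss_isoperimetry (A B : set rvect) (u : R) :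
  measurable A -> measurable B -> 0 <= u -> (0 < #|I|)%N ->
  (forall x y, A x -> B y -> u <= l1dist x y) ->
  (mu A * mu B <= (expR (- (u ^+ 2 / (4 * #|I|%:R))))%:E)%E.
Proof.
move=> mA mB u0 I0 sepAB.
have N0 : 0 < #|I|%:R :> R by rewrite ltr0n.
have [->|/set0P[x0 Ax0]] := eqVneq A set0; first by rewrite measure0 mul0e lee_fin expR_ge0.
(* The minimizer of #|I| lam^2 - lam u. *)
pose lam := u / (2 * #|I|%:R).
have lam0 : 0 <= lam by rewrite divr_ge0 // mulr_ge0 // ltW.
pose DA (y : I -> R) := [set l1dist x y | x in A].
pose F (y : I -> R) := lam * inf (DA y).
have dist0 (x y : I -> R) : 0 <= l1dist x y by apply: sumr_ge0.
have lbD y : has_lbound (DA y) by exists 0; move=> _ [x _ <-]; exact: dist0.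
have neD y : DA y !=set0 by exists (l1dist x0 y), x0.
have lipF : lipschitz_l1 lam F.
  move=> y z; rewrite /F -mulrBr ler_wpM2l // lerBlDr -lerBlDl.
  apply: lb_le_inf => // _ [x Ax <-]; rewrite lerBlDl.
  apply: (@le_trans _ _ (l1dist x y)); first by apply: ge_inf => //; exists x.
  by rewrite addrC [l1dist y z]l1distC l1dist_triangle.
have mF := measurable_lipschitz_l1 lam0 lipF.
have mE (H : rvect -> R) : measurable_fun setT H ->
    measurable_fun setT (fun y => expR (H y)).
  by move=> mH; exact: measurableT_comp (@measurable_expR R) mH.
have mNF : measurable_fun setT (fun y : rvect => - F y).
  by apply: measurableT_comp mF.
have AF : (mu A <= \int[mu]_y (expR (- F y))%:E)%E.
  rewrite -[leLHS]mul1e; apply: markov_ge0 => //; first exact: mE.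
  move=> y Ay; rewrite -expR0 ler_expR oppr_ge0 /F.
  rewrite mulr_ge0_le0 //; apply: ge_inf => //; exists y => //.
  by rewrite /l1dist big1 // => i _; rewrite subrr normr0.
have BF : ((expR (lam * u))%:E * mu B <= \int[mu]_y (expR (F y))%:E)%E.
  apply: markov_ge0 => //; first exact: mE.
  move=> y By; rewrite ler_expR ler_wpM2l //; apply: lb_le_inf => // _ [x Ax <-].
  exact: sepAB.
have depF : depends_on (index_enum I) F.
  move=> x y xy; congr F; apply/funext => i; apply: xy.
  by rewrite mem_index_enum.
have := lipschitz_exp_moments lam0 lipF depF.
have -> : size (index_enum I) = #|I| by rewrite cardT enumT.
move=> main.
have {}main : ((expR (lam * u))%:E * (mu A * mu B) <= (expR (#|I|%:R * lam ^+ 2))%:E)%E.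
  apply: le_trans main; rewrite muleCA [X in (X <= _)%E]muleC.
  by apply: lee_pmul => //; rewrite mule_ge0 // lee_fin expR_ge0.
have -> : - (u ^+ 2 / (4 * #|I|%:R)) = #|I|%:R * lam ^+ 2 - lam * u.
  by rewrite /lam; field; rewrite gt_eqF.
have e0 := expR_gt0 (lam * u).
rewrite -(@lee_pmul2l _ (expR (lam * u))%:E) ?lte_fin //.
by rewrite -EFinM -expRD addrC subrK.
Qed.

End concentration.

(** * Counting on the hypercube *)

Lemma eq_ler (R : realType) (x y : R) : x = y -> x <= y.
Proof. by move->. Qed.

Section hypercube.
Variables (R : realType) (n : nat).
Implicit Types s t : cube n.

Lemma hamming_sum s t : hamming s t = (\sum_i (s i != t i))%N.
Proof.
rewrite /hamming -sum1_card big_mkcond /=; apply: eq_bigr => i _.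
by rewrite inE; case: (s i != t i).
Qed.

Lemma hamming_le s t : (hamming s t <= n)%N.
Proof. by rewrite /hamming (leq_trans (max_card _)) ?card_ord. Qed.

(** The generating function of the Hamming distance to [s]. *)
Lemma sum_cube_expR (a b : R) s :
  \sum_t expR (a * (hamming s t)%:R + b * (n%:R - (hamming s t)%:R)) =
  (expR a + expR b) ^+ n.
Proof.
transitivity (\sum_(t : {ffun 'I_n -> bool}) \prod_i expR (if s i != t i then a else b)).
  apply: eq_bigr => t _; rewrite -expR_sum; congr expR.
  have -> : n%:R = \sum_(i < n) 1%:R :> R by rewrite -natr_sum sum1_card card_ord.
  rewrite hamming_sum natr_sum -sumrB !mulr_sumr -big_split.
  apply: eq_bigr => i _ /=.
  by case: (s i != t i); rewrite ?subrr ?subr0 ?mulr0 ?mulr1 ?addr0 ?add0r.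
rewrite -(bigA_distr_bigA (fun i (c : bool) => expR (if s i != c then a else b))) /=.
under eq_bigr => i _ do rewrite big_bool /=.
rewrite (eq_bigr (fun=> expR a + expR b)); first by rewrite prodr_const card_ord.
by move=> i _; case: (s i) => //=; rewrite addrC.
Qed.

Lemma card_cube_chernoff (a b c : R) s (A : pred (cube n)) :
  (forall t, A t -> c <= a * (hamming s t)%:R + b * (n%:R - (hamming s t)%:R)) ->
  #|A|%:R * expR c <= (expR a + expR b) ^+ n.
Proof.
move=> cA; rewrite -(sum_cube_expR a b s) -sum1_card natr_sum mulr_suml.
rewrite [leRHS](bigID A) /= ler_wpDr //; first by apply: sumr_ge0 => t _; exact: expR_ge0.
by apply: ler_sum => t At; rewrite mul1r ler_expR; exact: cA.
Qed.

Lemma expR_inv_le (x : R) : 0 < x -> expR (- x) <= x^-1.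
Proof.
move=> x0; rewrite expRN lef_pV2 ?posrE ?expR_gt0 //.
by apply: le_trans (expR_ge1Dx x); rewrite lerDr.
Qed.

(** Exponential Markov inequality with parameter [2 / k], written so as to cover
    balls around [s] and around its antipode. *)
Lemma card_ball_chernoff (k : R) (a b : R) s (A : pred (cube n)) : 0 < k ->
  a = - (2 / k) /\ b = 0 \/ a = 0 /\ b = - (2 / k) ->
  (forall t, A t -> - (2 / k) * (k ^+ 2 / 4 * n%:R) <=
     a * (hamming s t)%:R + b * (n%:R - (hamming s t)%:R)) ->
  #|A|%:R <= expR (k * n%:R).
Proof.
move=> k0 ab /card_cube_chernoff.
have eab : expR a + expR b <= expR (k / 2).
  apply: (@le_trans _ _ (1 + k / 2)); last exact: expR_ge1Dx.
  have h : expR (- (2 / k)) <= k / 2.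
    by rewrite (le_trans (expR_inv_le _)) ?divr_gt0 // invf_div.
  by case: ab => -[-> ->]; rewrite expR0; [rewrite addrC|]; rewrite lerD2l.
move=> h; rewrite -(ler_pM2r (expR_gt0 (- (2 / k) * (k ^+ 2 / 4 * n%:R)))).
apply: (le_trans h); apply: (@le_trans _ _ (expR (k / 2) ^+ n)).
  by rewrite lerXn2r // nnegrE ?addr_ge0 ?expR_ge0.
rewrite -expRM_natl -expRD ler_expR; apply: eq_ler; field; rewrite gt_eqF //.
Qed.

(** A ball of radius [k ^+ 2 / 4 * n] has at most [expR (k * n)] points. *)
Lemma card_ball (k : R) s : 0 < k ->
  #|[pred t | (hamming s t)%:R <= k ^+ 2 / 4 * n%:R]|%:R <= expR (k * n%:R).
Proof.
move=> k0; apply: (@card_ball_chernoff _ (- (2 / k)) 0 s) => //; first by left.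
move=> t /= ht; rewrite mul0r addr0 !mulNr lerN2 ler_wpM2l //.
by rewrite divr_ge0 // ltW.
Qed.

(** The same count around the antipode of [s]. *)
Lemma card_antiball (k : R) s : 0 < k ->
  #|[pred t | n%:R - (hamming s t)%:R <= k ^+ 2 / 4 * n%:R]|%:R <= expR (k * n%:R).
Proof.
move=> k0; apply: (@card_ball_chernoff _ 0 (- (2 / k)) s) => //; first by right.
move=> t /= ht; rewrite mul0r add0r !mulNr lerN2 ler_wpM2l //.
by rewrite divr_ge0 // ltW.
Qed.

(** From [expR y <= (1 - y)^-1] for [y < 1]. *)
Lemma expR_cosh_gauss (x : R) : `|x| <= 1 / 2 ->
  expR x + expR (- x) <= 2 * expR (2 * x ^+ 2).
Proof.
rewrite ler_norml => /andP[x1 x2].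
have lt1 (y : R) : y < 1 -> expR y <= (1 - y)^-1.
  move=> y1; rewrite -[y in expR y]opprK expRN lef_pV2 ?posrE ?subr_gt0 ?expR_gt0 //.
  exact: expR_ge1Dx.
apply: (@le_trans _ _ ((1 - x)^-1 + (1 + x)^-1)).
  have h1 : expR x <= (1 - x)^-1 by apply: lt1; lra.
  have h2 : expR (- x) <= (1 - - x)^-1 by apply: lt1; lra.
  by rewrite opprK in h2; exact: lerD.
have -> : (1 - x)^-1 + (1 + x)^-1 = 2 / (1 - x ^+ 2).
  by field; apply/and3P; split; apply/eqP; nra.
rewrite ler_pM2l //; apply: (@le_trans _ _ (1 + 2 * x ^+ 2)); last exact: expR_ge1Dx.
have : x ^+ 2 <= 1 / 4 by rewrite expr2; nra.
move: (sqr_ge0 x); move: (x ^+ 2) => u u0 u1.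
rewrite -[leLHS]mul1r ler_pdivrMr; last by lra.
have := mulr_ge0 u0 (_ : 0 <= 1 - 2 * u); nra.
Qed.

(** The normalized scalar product of [s] and [t], in terms of their distance. *)
Definition overlap s t : R := 1 - 2 * (hamming s t)%:R / n%:R.

(** Configurations at overlap [1 - 2 * m / n] with [s] are rarer than typical ones
    by a factor that is Gaussian in the overlap. *)
Lemma card_sphere s (m : nat) : (0 < n)%N -> (m <= n)%N ->
  #|[pred t | hamming s t == m]|%:R <=
  2 ^+ n * expR (- (n%:R * (1 - 2 * m%:R / n%:R) ^+ 2 / 8)) :> R.
Proof.
move=> n0 mn; have n0' : 0 < n%:R :> R by rewrite ltr0n.
set r : R := 1 - 2 * m%:R / n%:R.
have h1 : m%:R / n%:R <= 1 :> R by rewrite ler_pdivrMr // mul1r ler_nat.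
have h0 : 0 <= m%:R / n%:R :> R by rewrite divr_ge0.
have [r1 r2] : -1 <= r /\ r <= 1 by rewrite /r -mulrA; split; lra.
have : #|[pred t | hamming s t == m]|%:R * expR (n%:R * r ^+ 2 / 4) <=
    (expR (- (r / 4)) + expR (r / 4)) ^+ n.
  apply: (@card_cube_chernoff (- (r / 4)) (r / 4) _ s) => t /= /eqP ->.
  by apply: eq_ler; rewrite /r; field; rewrite gt_eqF.
move=> h; rewrite -(ler_pM2r (expR_gt0 (n%:R * r ^+ 2 / 4))).
apply: (le_trans h).
apply: (@le_trans _ _ ((2 * expR (2 * (r / 4) ^+ 2)) ^+ n)).
  rewrite lerXn2r // ?nnegrE ?addr_ge0 ?mulr_ge0 ?expR_ge0 // addrC.
  by apply: expR_cosh_gauss; rewrite ler_norml; apply/andP; split; lra.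
rewrite exprMn -[leRHS]mulrA; apply: ler_wpM2l; first by rewrite exprn_ge0.
by rewrite -expRM_natl -expRD ler_expR; apply: eq_ler; field.
Qed.

End hypercube.

(** * The Hamiltonian as a Gaussian linear form *)

Section hamiltonian.
Variables (R : realType) (p n : nat).
Hypothesis n_gt0 : (0 < n)%N.
Local Notation I := {ffun 'I_p -> 'I_n}.
Local Notation rvect := (rvect R I).
Implicit Types s t : cube n.

Let n0 : 0 < n%:R :> R. Proof. by rewrite ltr0n. Qed.

(** The coefficient of the coupling [J_i] in the energy of [s]. *)
Definition ham_coef s (i : I) : R :=
  n%:R `^ (- (p.+1%:R / 2)) * \prod_(k < p) spin R s (i k).

Lemma hamiltonianE (y : I -> R) s : hamiltonian y s = \sum_i ham_coef s i * y i.
Proof.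
by rewrite /hamiltonian mulr_sumr; apply: eq_bigr => i _; rewrite mulrA mulrAC.
Qed.

Lemma sum_spin_spin s t : \sum_j spin R s j * spin R t j = n%:R * overlap R s t.
Proof.
have -> : n%:R * overlap R s t = n%:R - 2 * (hamming s t)%:R.
  by rewrite /overlap; field; rewrite gt_eqF.
have -> : n%:R = \sum_(i < n) 1%:R :> R by rewrite -natr_sum sum1_card card_ord.
rewrite hamming_sum natr_sum mulr_sumr -sumrB; apply: eq_bigr => j _.
by rewrite /spin; case: (s j); case: (t j) => /=; ring.
Qed.

(** This makes the energy of each configuration have variance [1 / n]. *)
Lemma ham_scale : (n%:R `^ (- (p.+1%:R / 2)) : R) ^+ 2 = n%:R ^- p.+1.
Proof.
rewrite -powR_mulrn ?powR_ge0 // -powRrM mulNr divfK ?pnatr_eq0 //.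
by rewrite powR_invn ?ler0n.
Qed.

Lemma ham_cov s t : \sum_i ham_coef s i * ham_coef t i = overlap R s t ^+ p / n%:R.
Proof.
transitivity (n%:R ^- p.+1 * (\sum_j spin R s j * spin R t j) ^+ p).
  have -> (x : R) : x ^+ p = \prod_(k < p) x by rewrite prodr_const card_ord.
  rewrite (bigA_distr_bigA (fun (_ : 'I_p) j => spin R s j * spin R t j)) mulr_sumr.
  apply: eq_bigr => i _; rewrite big_split /= -ham_scale /ham_coef; ring.
rewrite sum_spin_spin exprMn exprS; field.
by rewrite expf_neq0 gt_eqF.
Qed.

Lemma overlapss s : overlap R s s = 1.
Proof.
have -> : overlap R s s = 1 - 2 * (hamming s s)%:R / n%:R by [].
rewrite hamming_sum big1 ?mulr0 ?mul0r ?subr0 // => i _.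
by rewrite eqxx.
Qed.

Variable mu : probability rvect R.
Hypothesis mu_gauss : iid_gauss mu.

Lemma measurable_hamiltonian s : measurable_fun setT (fun y : rvect => hamiltonian y s).
Proof.
rewrite (_ : (fun y : rvect => _) = fun y => \sum_i ham_coef s i * y i).
  exact: measurable_linear_form.
by apply/funext => y; exact: hamiltonianE.
Qed.

(** The couplings for which [s] has energy at least [h]. *)
Definition ham_ge s (h : R) : set rvect := [set y | h <= hamiltonian y s].

Lemma measurable_ham_ge s (h : R) : measurable (ham_ge s h).
Proof.
rewrite /ham_ge -preimage_itvcy -[_ @^-1` _]setTI.
exact: measurable_hamiltonian.
Qed.

Lemma ham_mgf s t (u v : R) :
  (\int[mu]_y (expR (u * hamiltonian y s + v * hamiltonian y t))%:E =
   (expR ((u ^+ 2 + v ^+ 2 + 2 * u * v * overlap R s t ^+ p) / (2 * n%:R)))%:E)%E.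
Proof.
pose a i := u * ham_coef s i + v * ham_coef t i.
transitivity (\int[mu]_y (expR (\sum_i a i * y i))%:E)%E.
  apply: eq_integral => y _; congr (expR _)%:E.
  rewrite !hamiltonianE !mulr_sumr -big_split; apply: eq_bigr => i _ /=.
  by rewrite /a; ring.
rewrite (integral_expR_linear mu_gauss); congr (expR _)%:E.
transitivity ((u ^+ 2 * (\sum_i ham_coef s i * ham_coef s i) +
  v ^+ 2 * (\sum_i ham_coef t i * ham_coef t i) +
  2 * u * v * (\sum_i ham_coef s i * ham_coef t i)) / 2).
  rewrite !mulr_sumr -!big_split mulr_suml; apply: eq_bigr => i _ /=.
  by rewrite /a; ring.
rewrite !ham_cov !overlapss expr1n; field.
by rewrite gt_eqF.
Qed.

(** Exponential Markov inequality for the sum of two energies. *)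
Lemma ham_pair_tail s t (h r : R) : 0 <= h -> 0 <= r -> overlap R s t ^+ p <= r ->
  (mu (ham_ge s h `&` ham_ge t h) <=
   (expR (- (n%:R * h ^+ 2 / (1 + r))))%:E)%E.
Proof.
move=> h0 r0 ovr.
have r1 : 0 < 1 + r by lra.
(* The optimal exponential tilt when the correlation is r. *)
pose lam := h / (1 + r) * n%:R.
have lam0 : 0 <= lam by rewrite mulr_ge0 // ?divr_ge0 // ltW.
set A := (X in mu X).
have mA : measurable A.
  by apply: measurableI; exact: measurable_ham_ge.
have mH : measurable_fun setT (fun y : rvect =>
    expR (lam * hamiltonian y s + lam * hamiltonian y t)).
  apply: (measurableT_comp (@measurable_expR R)); apply: measurable_funD.
    by apply: measurable_funM => //; exact: measurable_hamiltonian.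
  by apply: measurable_funM => //; exact: measurable_hamiltonian.
have := @markov_ge0 _ _ _ mu _ (expR (2 * lam * h)) _ mH mA.
rewrite ham_mgf => /(_ (fun=> expR_ge0 _) (expR_ge0 _)) markov.
have {}markov := markov _.
have e0 := expR_gt0 (2 * lam * h).
rewrite -(@lee_pmul2l _ (expR (2 * lam * h))%:E) ?lte_fin //.
apply: le_trans (markov _) _.
  move=> y [hs ht]; rewrite ler_expR; have := ler_wpM2l lam0 hs; have := ler_wpM2l lam0 ht; lra.
rewrite -EFinM -expRD lee_fin ler_expR.
apply: (@le_trans _ _ (lam ^+ 2 * (1 + r) / n%:R)).
  rewrite ler_pdivrMr; last by rewrite mulr_gt0.
  rewrite (_ : _ / _ * _ = 2 * (lam ^+ 2 * (1 + r))); last by field; rewrite gt_eqF.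
  have := ler_wpM2l (sqr_ge0 lam) ovr; rewrite expr2; lra.
apply: eq_ler; rewrite /lam; field; by rewrite gt_eqF //= gt_eqF.
Qed.

Lemma ham_tail s (h : R) : 0 <= h ->
  (mu (ham_ge s h) <= (expR (- (n%:R * h ^+ 2 / 2)))%:E)%E.
Proof.
move=> h0; have := @ham_pair_tail s s h 1 h0 ler01; rewrite overlapss expr1n => /(_ (lexx _)).
by rewrite setIid.
Qed.

Lemma ham_mgf1 s (u : R) :
  (\int[mu]_y (expR (u * hamiltonian y s))%:E = (expR (u ^+ 2 / (2 * n%:R)))%:E)%E.
Proof.
have := ham_mgf s s u 0; rewrite expr0n /= !mulr0 mul0r !addr0 => <-.
by apply: eq_integral => y _; rewrite mul0r addr0.
Qed.

(** A matching lower bound: under the tilt [expR (b * n * H)] the energy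
    concentrates at [b], with tails given by the same exponential moments. *)
Lemma ham_lower s (b x : R) : 0 <= b -> 0 <= x ->
  ((expR (- (n%:R * (b ^+ 2 / 2 + b * x))) * (1 - 2 * expR (- (n%:R * x ^+ 2 / 2))))%:E <=
  mu (ham_ge s (b - x)))%E.
Proof.
move=> b0 x0.
set H := fun y : rvect => hamiltonian y s.
have mH : measurable_fun setT H by exact: measurable_hamiltonian.
have mA := measurable_ham_ge s (b - x).
set A := ham_ge s (b - x) in mA *.
have mE (c : R) : measurable_fun setT (fun y => expR (c * H y)).
  by apply: (measurableT_comp (@measurable_expR R)); apply: measurable_funM.
pose N : R := n%:R.
(* On A the tilted weight is at most its value at b + x, or else it is
   dominated by the weight tilted further by +x; off A, by -x. *)
pose f y := expR (- (x * N * (b + x))) * expR ((b + x) * N * H y) +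
            expR (x * N * (b - x)) * expR ((b - x) * N * H y).
have le : (\int[mu]_y (expR (b * N * H y))%:E <=
    \int[mu]_y (expR (b * N * (b + x)) * \1_A y + 1 * f y)%:E)%E.
  apply: ge0_integral_mono.
  - exact: mE.
  - apply: measurable_funD; first by apply: measurable_funM => //; exact: measurable_indic.
    apply: measurable_funM => //.
    by apply: measurable_funD; apply: measurable_funM => //; exact: mE.
  - by move=> y; rewrite expR_ge0.
  - have N0 : 0 <= N by rewrite ltW.
    have bN0 : 0 <= b * N by rewrite mulr_ge0.
    have xN0 : 0 <= x * N by rewrite mulr_ge0.
    move=> y; rewrite mul1r /f -!expRD.
    have e1 := expR_ge0 (- (x * N * (b + x)) + (b + x) * N * H y).
    have e2 := expR_ge0 (x * N * (b - x) + (b - x) * N * H y).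
    have e3 : 0 <= expR (b * N * (b + x)) * \1_A y.
      by rewrite mulr_ge0 ?expR_ge0.
    case: (lerP (H y) (b + x)) => [Hle|Hgt]; last first.
      have : expR (b * N * H y) <= expR (- (x * N * (b + x)) + (b + x) * N * H y).
        rewrite ler_expR; have := ler_wpM2l xN0 (ltW Hgt); lra.
      lra.
    case: (lerP (b - x) (H y)) => [Hge|Hlt].
      have : expR (b * N * H y) <= expR (b * N * (b + x)).
        by rewrite ler_expR ler_wpM2l.
      have -> : \1_A y = 1 :> R by rewrite indicE mem_set.
      lra.
    have : expR (b * N * H y) <= expR (x * N * (b - x) + (b - x) * N * H y).
      rewrite ler_expR; have := ler_wpM2l xN0 (ltW Hlt); lra.
    lra.
move: le; rewrite ge0_integral_lin2 ?expR_ge0 //; last 2 first.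
- by apply: measurable_funD; apply: measurable_funM => //; exact: mE.
- by move=> y; rewrite addr_ge0 // mulr_ge0 ?expR_ge0.
rewrite integral_indic // setIT mul1e ge0_integral_lin2 ?expR_ge0 //.
rewrite !ham_mgf1 -/N => le.
have N_neq0 : N != 0 by rewrite gt_eqF.
have {}le : ((expR (N * b ^+ 2 / 2) * (1 - 2 * expR (- (N * x ^+ 2 / 2))))%:E <=
    (expR (b * N * (b + x)))%:E * mu A)%E.
  have e1 : (b * N) ^+ 2 / (2 * N) = N * b ^+ 2 / 2 by field.
  have e2 : expR (- (x * N * (b + x))) * expR (((b + x) * N) ^+ 2 / (2 * N)) =
      expR (N * b ^+ 2 / 2) * expR (- (N * x ^+ 2 / 2)).
    by rewrite -!expRD; congr expR; field.
  have e3 : expR (x * N * (b - x)) * expR (((b - x) * N) ^+ 2 / (2 * N)) =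
      expR (N * b ^+ 2 / 2) * expR (- (N * x ^+ 2 / 2)).
    by rewrite -!expRD; congr expR; field.
  move: le; rewrite e1 -!EFinM e2 e3 -EFinD -leeBlDr // -EFinB => le.
  by apply: le_trans le; rewrite lee_fin; apply: eq_ler; ring.
have e0 := expR_gt0 (b * N * (b + x)).
rewrite -(@lee_pmul2l _ (expR (b * N * (b + x)))%:E) ?lte_fin //.
apply: le_trans le; rewrite -EFinM lee_fin mulrA -expRD.
by apply: eq_ler; congr (expR _ * _); rewrite /N; field.
Qed.

End hamiltonian.

(** * First and second moment methods *)

Section moment_tools.
Variables (R : realType) (d : measure_display) (T : measurableType d).
Variable mu : probability T R.

Lemma integral_sum_indic (J : finType) (Q : pred J) (E : J -> set T) :
  (forall j, measurable (E j)) ->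
  (\int[mu]_x (\sum_(j | Q j) \1_(E j) x)%:E = \sum_(j | Q j) mu (E j))%E.
Proof.
move=> mE.
under eq_integral do rewrite -big_filter -sumEFin.
rewrite ge0_integral_sum //.
- by rewrite big_filter; apply: eq_bigr => j _; rewrite integral_indic // setIT.
- by move=> j; apply/measurable_EFinP; exact: measurable_indic.
Qed.

Lemma measurable_sum_indic (J : finType) (Q : pred J) (E : J -> set T) :
  (forall j, measurable (E j)) ->
  measurable_fun setT (fun x => \sum_(j | Q j) \1_(E j) x : R).
Proof.
move=> mE; under eq_fun do rewrite -big_filter.
by apply: measurable_fun_bigsum => j; exact: measurable_indic.
Qed.

(** The Paley--Zygmund inequality for a lower bound on the mean and an upper bound
    on the second moment. *)
Lemma paley_zygmund (N : T -> R) (a s : R) :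
  measurable_fun setT N -> (forall x, 0 <= N x) -> 0 < a -> 0 < s ->
  (a%:E <= \int[mu]_x (N x)%:E)%E -> (\int[mu]_x (N x ^+ 2)%:E <= s%:E)%E ->
  ((a ^+ 2 / (4 * s))%:E <= mu [set x | (a / 2 <= N x)%R])%E.
Proof.
move=> mN N0 a0 s0 aN Ns; set A := (X in mu X).
have mA : measurable A.
  by rewrite /A -preimage_itvcy -[_ @^-1` _]setTI; exact: mN.
have mN2 : measurable_fun setT (fun x => N x ^+ 2) by exact: measurable_funX.
(* The value of c that balances the two terms of the bound below. *)
pose c := 2 * s / a.
have c0 : 0 < c by rewrite divr_gt0 // mulr_gt0.
(* Pointwise N <= a / 2 off A, and N <= N^2 / (2 c) + c / 2 on A. *)
have le1 : (\int[mu]_x (N x)%:E <=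
    \int[mu]_x (1 * (a / 2) + 1 * ((2 * c)^-1 * N x ^+ 2 + c / 2 * \1_A x))%:E)%E.
  apply: ge0_integral_mono => //.
    apply: measurable_funD => //; apply: measurable_funM => //.
    by apply: measurable_funD; apply: measurable_funM.
  move=> x; rewrite !mul1r; case: (lerP (a / 2) (N x)) => [Nx|Nx].
    have -> : \1_A x = 1 :> R by rewrite indicE mem_set.
    have -> : (2 * c)^-1 * N x ^+ 2 + c / 2 * 1 = N x + (N x - c) ^+ 2 / (2 * c).
      by field; rewrite gt_eqF.
    have : 0 <= (N x - c) ^+ 2 / (2 * c) by rewrite divr_ge0 ?sqr_ge0 // mulr_ge0 // ltW.
    lra.
  have h1 : 0 <= (2 * c)^-1 * N x ^+ 2 by rewrite mulr_ge0 ?sqr_ge0 // invr_ge0 mulr_ge0 // ltW.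
  have h2 : 0 <= c / 2 * \1_A x :> R by rewrite mulr_ge0 // divr_ge0 // ltW.
  lra.
have c1 : 0 <= (2 * c)^-1 by rewrite invr_ge0 mulr_ge0 // ltW.
have c2 : 0 <= c / 2 by rewrite divr_ge0 // ltW.
have a2 : 0 <= a / 2 by rewrite divr_ge0 // ltW.
move: le1; rewrite ge0_integral_lin2 //; last 2 first.
- by apply: measurable_funD; apply: measurable_funM.
- by move=> x; rewrite addr_ge0 // mulr_ge0 // sqr_ge0.
rewrite (ge0_integral_lin2 mu (f := fun x => N x ^+ 2)) //; last first.
  by move=> x; rewrite sqr_ge0.
rewrite !mul1e integral_indic // setIT integral_cst //= probability_setT mule1.
move=> le1.
have [m muA] : exists m, mu A = m%:E.
  by exists (fine (mu A)); rewrite fineK // fin_num_measure.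
rewrite muA in le1 *.
have : (a%:E <= (a / 2 + ((2 * c)^-1 * s + c / 2 * m))%:E)%E.
  apply: (le_trans aN); apply: (le_trans le1).
  by rewrite EFinD leeD2l // EFinD leeD // EFinM lee_wpmul2l // lee_fin.
rewrite !lee_fin => h.
have e1 : (2 * c)^-1 * s = a / 4 by rewrite /c; field; rewrite !gt_eqF.
have e2 : c / 2 = s / a by rewrite /c; field; rewrite gt_eqF.
rewrite e1 e2 in h.
rewrite ler_pdivrMr; last by rewrite mulr_gt0.
have h3 : a / 4 <= s / a * m by lra.
have := ler_wpM2l (ltW a0) h3.
have -> : a * (s / a * m) = s * m by field; rewrite gt_eqF.
rewrite expr2; lra.
Qed.

End moment_tools.

(** * Level sets of the Hamiltonian *)

Section level_sets.
Variables (R : realType) (p n : nat).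
Hypothesis n_gt0 : (0 < n)%N.
Local Notation I := {ffun 'I_p -> 'I_n}.
Local Notation rvect := (rvect R I).
Implicit Types s t : cube n.
Variable mu : probability rvect R.
Hypothesis mu_gauss : iid_gauss mu.

Let n0 : 0 < n%:R :> R. Proof. by rewrite ltr0n. Qed.

(** The configurations of energy at least [h]; [superlevel] at [eps] is the level
    set at [(1 - eps) * Num.sqrt (2 * ln 2)]. *)
Definition level_set (h : R) (y : rvect) : {set cube n} :=
  finset (fun s => h <= hamiltonian y s).

Lemma in_level_set h (y : rvect) s : (s \in level_set h y) = (h <= hamiltonian y s).
Proof. by rewrite inE. Qed.

Lemma measurable_level_set h (A : {set cube n}) :
  measurable [set y | level_set h y = A].
Proof.
rewrite (_ : [set y | _] = \big[setI/setT]_(s <- index_enum (cube n))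
   (if s \in A then ham_ge s h else ~` ham_ge s h)).
  apply: bigsetI_measurable => s _; case: ifP => _; last apply: measurableC.
    exact: measurable_ham_ge.
  exact: measurable_ham_ge.
rewrite -bigcap_seq; apply/seteqP; split => y /=.
  move=> <- s _; rewrite in_level_set; case: ifPn => // + h1.
  by rewrite /ham_ge /= in h1; rewrite h1.
move=> H; apply/setP => s; rewrite in_level_set; apply/idP/idP => [hs|sA].
  by have := H s (mem_index_enum s); case: ifPn => //= _ /(_ hs).
by have := H s (mem_index_enum s); rewrite /= sA.
Qed.

Lemma measurable_level_sets2 h h' (Q : {set cube n} -> {set cube n} -> Prop) :
  measurable [set y | Q (level_set h y) (level_set h' y)].
Proof.
rewrite (_ : [set y | _] = \big[setU/set0]_(AB <- index_enum _ | `[< Q AB.1 AB.2 >])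
   ([set y | level_set h y = AB.1] `&` [set y | level_set h' y = AB.2])).
  by apply: bigsetU_measurable => AB _; apply: measurableI; exact: measurable_level_set.
rewrite -bigcup_seq_cond; apply/seteqP; split => y /=.
  move=> H; exists (level_set h y, level_set h' y) => //=.
  by rewrite mem_index_enum; exact/asboolP.
by case=> -[A B] /= /andP[_ /asboolP QAB] [-> ->].
Qed.

Lemma measurable_level_set_prop h (Q : {set cube n} -> Prop) :
  measurable [set y | Q (level_set h y)].
Proof. exact: (measurable_level_sets2 h h (fun A _ => Q A)). Qed.

Lemma card_level_setE h y :
  #|level_set h y|%:R = \sum_(s : cube n) \1_(ham_ge s h) y :> R.
Proof.
rewrite -sum1_card natr_sum big_mkcond; apply: eq_bigr => s _ /=.
rewrite in_level_set indicE; case: (boolP (h <= _)) => hs; first by rewrite mem_set.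
by rewrite memNset //; apply/negP.
Qed.

Lemma card_level_set_sqE h y :
  #|level_set h y|%:R ^+ 2 =
  \sum_(st : cube n * cube n) \1_(ham_ge st.1 h `&` ham_ge st.2 h) y :> R.
Proof.
rewrite card_level_setE expr2 mulr_suml.
rewrite -(pair_bigA _ (fun s t => \1_(ham_ge s h `&` ham_ge t h) y)) /=.
by apply: eq_bigr => s _; rewrite mulr_sumr; apply: eq_bigr => t _; rewrite indicI.
Qed.

Lemma card_cubeE : #|{: cube n}|%:R = 2 ^+ n :> R.
Proof. by rewrite card_ffun card_bool card_ord natrX. Qed.

Lemma measurable_card_level_set h : measurable_fun setT (fun y => #|level_set h y|%:R : R).
Proof.
rewrite (_ : (fun y : rvect => _) = fun y => \sum_(s : cube n) \1_(ham_ge s h) y).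
  by apply: measurable_sum_indic => s; exact: measurable_ham_ge.
by apply/funext => y; exact: card_level_setE.
Qed.

Lemma card_level_set_markov (h K : R) : 0 <= h -> 0 < K ->
  (mu [set y | (K <= #|level_set h y|%:R)%R] <=
   (2 ^+ n * expR (- (n%:R * h ^+ 2 / 2)) / K)%:E)%E.
Proof.
move=> h0 K0; set A := (X in mu X).
have mA : measurable A := measurable_level_set_prop h (fun A => K <= #|A|%:R).
have := @markov_ge0 _ _ _ mu _ K A (measurable_card_level_set h) mA.
move=> /(_ (fun=> ler0n _ _) (ltW K0) (fun=> id)).
under eq_integral do rewrite card_level_setE.
rewrite integral_sum_indic; last by move=> s; exact: measurable_ham_ge.
move=> le; rewrite -(@lee_pmul2l _ K%:E) ?lte_fin //; apply: (le_trans le).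
rewrite -EFinM mulrC divfK ?gt_eqF // -card_cubeE -sum1_card natr_sum mulr_suml.
rewrite -sumEFin; apply: lee_sum => s _; rewrite mul1r.
exact: ham_tail.
Qed.

Lemma card_level_set_first_moment (b x : R) : 0 <= b -> 0 <= x ->
  ((2 ^+ n * (expR (- (n%:R * (b ^+ 2 / 2 + b * x))) *
    (1 - 2 * expR (- (n%:R * x ^+ 2 / 2)))))%:E <=
   \int[mu]_y (#|level_set (b - x) y|%:R)%:E)%E.
Proof.
move=> b0 x0; under eq_integral do rewrite card_level_setE.
rewrite integral_sum_indic; last by move=> s; exact: measurable_ham_ge.
rewrite -card_cubeE -sum1_card natr_sum mulr_suml -sumEFin.
by apply: lee_sum => s _; rewrite mul1r; exact: ham_lower.
Qed.

(** If at least [K] configurations exceed the level [h1] with a probability that is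
    not too small, then it is very unlikely that fewer than [K] exceed the lower
    level [h0], by [gauss_isoperimetry]. *)
Lemma level_sets_concentration (h0 h1 K : R) : h0 <= h1 ->
  (mu [set y | (K <= #|level_set h1 y|%:R)%R] * mu [set y | (#|level_set h0 y|%:R < K)%R] <=
   (expR (- (n%:R * (h1 - h0) ^+ 2 / 4)))%:E)%E.
Proof.
move=> h01.
pose c : R := n%:R `^ (- (p.+1%:R / 2)).
have c0 : 0 < c by rewrite powR_gt0.
pose u := (h1 - h0) / c.
have cardI : #|I|%:R = n%:R ^+ p :> R by rewrite card_ffun !card_ord natrX.
have -> : n%:R * (h1 - h0) ^+ 2 / 4 = u ^+ 2 / (4 * #|I|%:R).
  have := ham_scale R p n; rewrite -/c => e.
  rewrite /u expr_div_n e cardI [n%:R ^+ p.+1]exprS; field.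
  by rewrite expf_neq0 gt_eqF.
apply: gauss_isoperimetry => //.
- exact: (measurable_level_set_prop h1 (fun A => K <= #|A|%:R)).
- exact: (measurable_level_set_prop h0 (fun A => #|A|%:R < K)).
- by rewrite divr_ge0 // ?subr_ge0 // ltW.
- by rewrite card_ffun !card_ord expn_gt0 n_gt0.
move=> x y /= Kx Ky; rewrite leNgt; apply/negP => dist.
(* Moving from x to y changes every energy by at most c times the distance. *)
suff : level_set h1 x \subset level_set h0 y.
  move=> /subset_leq_card; rewrite -(ler_nat R) => le.
  by have := lt_le_trans Ky (le_trans Kx le); rewrite ltxx.
apply/fintype.subsetP => s; rewrite !in_level_set => hs.
have : hamiltonian x s - hamiltonian y s <= c * l1dist x y.
  rewrite !hamiltonianE -sumrB /l1dist mulr_sumr; apply: ler_sum => i _.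
  rewrite -mulrBr (le_trans (ler_norm _)) // normrM ler_wpM2r //.
  rewrite /ham_coef normrM normr_prod (ger0_norm (powR_ge0 _ _)) big1 ?mulr1 //.
  by move=> k _; rewrite /spin; case: ifP; rewrite ?normrN normr1.
have : c * l1dist x y <= h1 - h0.
  by move: dist; rewrite /u ltr_pdivlMr // mulrC => /ltW.
lra.
Qed.

End level_sets.

(** * Second moment of the size of a level set *)

Section second_moment.
Variables (R : realType) (n : nat).

Lemma sum_by_distance (s : cube n) (g : nat -> R) (c : R) :
  (forall m, (m <= n)%N -> #|[pred t | hamming s t == m]|%:R * g m <= c) ->
  \sum_t g (hamming s t) <= n.+1%:R * c.
Proof.
move=> gc.
rewrite (partition_big (fun t => inord (hamming s t) : 'I_n.+1) xpredT) //=.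
have -> : n.+1%:R * c = \sum_(m < n.+1) c by rewrite sumr_const card_ord mulr_natl.
apply: ler_sum => m _; apply: le_trans (gc m _); last by rewrite -ltnS.
have mE t : (inord (hamming s t) == m :> 'I_n.+1) = (hamming s t == m).
  by rewrite -val_eqE /= inordK // ltnS hamming_le.
rewrite (eq_bigr (fun=> g m)); last by move=> t; rewrite mE => /eqP ->.
rewrite -sum1_card natr_sum mulr_suml big_mkcond [leRHS]big_mkcond /=.
by apply: ler_sum => t _; rewrite mE inE; case: ifP; rewrite ?mul1r.
Qed.

Lemma ln2_le1 : ln 2 <= 1 :> R.
Proof. by rewrite -ler_expR lnK ?posrE //; have := expR_ge1Dx (1 : R). Qed.

Lemma pow2_expR : 2 ^+ n = expR (n%:R * ln 2) :> R.
Proof. by rewrite expRM_natl lnK ?posrE. Qed.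

(** The contribution of one overlap to the second moment never exceeds that of
    independent pairs. The hypothesis on [p - 2] is where [p] must be large. *)
Lemma card_sphere_weight (k h : R) (p : nat) (s : cube n) (m : nat) :
  (0 < n)%N -> (m <= n)%N -> 0 < k -> k ^+ 2 <= 2 ->
  h ^+ 2 <= 2 * ln 2 -> k + h ^+ 2 / 2 <= ln 2 ->
  (2 <= p)%N -> (1 - k ^+ 2 / 2) ^+ (p - 2) <= 1 / 16 ->
  #|[pred t | hamming s t == m]|%:R *
    expR (- (n%:R * h ^+ 2 / (1 + `|1 - 2 * m%:R / n%:R| ^+ p))) <=
  2 ^+ n * expR (- (n%:R * h ^+ 2)).
Proof.
move=> n_gt0 mn k0 k2 h2 kh p2 hp.
have n0 : 0 < n%:R :> R by rewrite ltr0n.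
have m1 : m%:R / n%:R <= 1 :> R by rewrite ler_pdivrMr // mul1r ler_nat.
have m0 : 0 <= m%:R / n%:R :> R by rewrite divr_ge0.
pose x : R := 1 - 2 * m%:R / n%:R.
rewrite -/x; set r := `|x| ^+ p.
have x1 : `|x| <= 1 by rewrite /x -mulrA ler_norml; apply/andP; split; lra.
have r0 : 0 <= r by rewrite exprn_ge0.
have r1 : r <= 1 by rewrite exprn_ile1.
have hh : 0 <= h ^+ 2 by exact: sqr_ge0.
have rr : 0 < 1 + r by lra.
have q0 : 0 <= r / (1 + r) by rewrite divr_ge0 // ltW.
have e1 : h ^+ 2 / (1 + r) = h ^+ 2 - h ^+ 2 * (r / (1 + r)) by field; rewrite gt_eqF.
have e2 : - (n%:R * h ^+ 2 / (1 + r)) = - (n%:R * h ^+ 2) + n%:R * (h ^+ 2 * (r / (1 + r))).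
  by rewrite -mulrA e1; ring.
rewrite e2 expRD mulrCA [leRHS]mulrC ler_wpM2l ?expR_ge0 //.
case: (lerP `|x| (1 - k ^+ 2 / 2)) => [xle|xgt].
  (* Moderate overlap: the entropy deficit n x^2 / 8 beats the correlation. *)
  have rle : r <= x ^+ 2 / 16.
    rewrite /r -(subnKC p2) exprD real_normK ?num_real //.
    rewrite ler_wpM2l ?sqr_ge0 // -[16^-1]mul1r.
    by apply: le_trans hp; rewrite lerXn2r ?nnegrE //; lra.
  apply: (@le_trans _ _ (2 ^+ n * expR (- (n%:R * x ^+ 2 / 8)) * expR (n%:R * (x ^+ 2 / 8)))).
    apply: ler_pM; rewrite ?expR_ge0 //; first exact: card_sphere.
    rewrite ler_expR ler_wpM2l ?(ltW n0) //.
    have q1 : r / (1 + r) <= r by rewrite ler_pdivrMr // ler_peMr //; lra.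
    have := ler_wpM2l hh q1; have := ln2_le1; have x2 := sqr_ge0 x; nra.
  have e3 : expR (- (n%:R * x ^+ 2 / 8)) * expR (n%:R * (x ^+ 2 / 8)) = 1.
    by rewrite -expRD -expR0; congr expR; field.
  by rewrite -mulrA e3 mulr1.
(* Overlap close to 1 or -1: few such configurations. *)
have few : #|[pred t | hamming s t == m]|%:R <= expR (k * n%:R) :> R.
  case: (ger0P x) xgt => _ xgt.
    apply: le_trans (card_ball s k0); rewrite ler_nat; apply: subset_leq_card.
    apply/fintype.subsetP => t; rewrite !inE => /eqP ->.
    rewrite -ler_pdivrMr //; move: xgt; rewrite /x -mulrA; lra.
  apply: le_trans (card_antiball s k0); rewrite ler_nat; apply: subset_leq_card.
  apply/fintype.subsetP => t; rewrite !inE => /eqP ->.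
  rewrite -ler_pdivrMr // mulrBl divff ?gt_eqF //; move: xgt; rewrite /x -mulrA; lra.
rewrite pow2_expR.
apply: (@le_trans _ _ (expR (k * n%:R) * expR (n%:R * (h ^+ 2 / 2)))).
  apply: ler_pM; rewrite ?expR_ge0 // ler_expR ler_wpM2l ?(ltW n0) // ler_wpM2l //.
  by rewrite ler_pdivrMr //; lra.
rewrite -expRD ler_expR mulrC -mulrDr ler_wpM2l // ltW //.
Qed.

Variable p : nat.
Local Notation I := {ffun 'I_p -> 'I_n}.
Local Notation rvect := (rvect R I).
Variable mu : probability rvect R.
Hypothesis mu_gauss : iid_gauss mu.
Hypothesis n_gt0 : (0 < n)%N.

Let n0 : 0 < n%:R :> R. Proof. by rewrite ltr0n. Qed.

(** Up to the number [n.+1] of possible distances, the second moment is of the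
    order of the squared first moment. *)
Lemma card_level_set_second_moment (k h : R) :
  0 < k -> k ^+ 2 <= 2 -> 0 <= h ->
  h ^+ 2 <= 2 * ln 2 -> k + h ^+ 2 / 2 <= ln 2 ->
  (2 <= p)%N -> (1 - k ^+ 2 / 2) ^+ (p - 2) <= 1 / 16 ->
  (\int[mu]_y ((#|level_set h y|%:R) ^+ 2)%:E <=
   (n.+1%:R * (2 ^+ n) ^+ 2 * expR (- (n%:R * h ^+ 2)))%:E)%E.
Proof.
move=> k0 k2 h0 h2 kh p2 hp.
under eq_integral do rewrite card_level_set_sqE.
rewrite integral_sum_indic; last first.
  by move=> st; apply: measurableI; exact: measurable_ham_ge.
pose g (m : nat) := expR (- (n%:R * h ^+ 2 / (1 + `|1 - 2 * m%:R / n%:R| ^+ p))).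
apply: (@le_trans _ _ (\sum_(st : cube n * cube n) (g (hamming st.1 st.2))%:E)%E).
  apply: lee_sum => -[s t] _ /=.
  apply: (ham_pair_tail n_gt0 mu_gauss) => //.
  by rewrite -normrX ler_norm.
rewrite sumEFin lee_fin.
rewrite -(pair_bigA _ (fun s t => g (hamming s t))) /=.
have -> : n.+1%:R * (2 ^+ n) ^+ 2 * expR (- (n%:R * h ^+ 2)) =
    \sum_(s : cube n) n.+1%:R * (2 ^+ n * expR (- (n%:R * h ^+ 2))).
  rewrite sumr_const -[RHS]mulr_natl card_cubeE; ring.
apply: ler_sum => s _; apply: sum_by_distance => m mn.
exact: (@card_sphere_weight k).
Qed.

(** Paley--Zygmund at the level [b - x]: the probability is bounded below by an
    exponential whose rate vanishes with [x]. *)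
Lemma card_level_set_many (k b x : R) :
  0 < k -> k ^+ 2 <= 2 -> 0 < x -> x <= b ->
  (b - x) ^+ 2 <= 2 * ln 2 -> k + (b - x) ^+ 2 / 2 <= ln 2 ->
  (2 <= p)%N -> (1 - k ^+ 2 / 2) ^+ (p - 2) <= 1 / 16 ->
  2 * expR (- (n%:R * x ^+ 2 / 2)) <= 1 / 2 ->
  ((expR (- (n%:R * (b ^+ 2 + 2 * b * x - (b - x) ^+ 2))) / (16 * n.+1%:R))%:E <=
   mu [set y | (expR (n%:R * (ln 2 - (b ^+ 2 / 2 + b * x))) / 4 <=
                #|level_set (b - x) y|%:R)%R])%E.
Proof.
move=> k0 k2 x0 xb h2 kh p2 hp nx.
have b0 : 0 <= b by lra.
have h0 : 0 <= b - x by lra.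
pose a : R := expR (n%:R * (ln 2 - (b ^+ 2 / 2 + b * x))) / 2.
pose s : R := n.+1%:R * (2 ^+ n) ^+ 2 * expR (- (n%:R * (b - x) ^+ 2)).
have a0 : 0 < a by rewrite divr_gt0 ?expR_gt0.
have s0 : 0 < s by rewrite !mulr_gt0 ?exprn_gt0 ?expR_gt0 ?ltr0n.
have := @paley_zygmund _ _ _ mu (fun y => #|level_set (b - x) y|%:R) a s.
have -> : a / 2 = expR (n%:R * (ln 2 - (b ^+ 2 / 2 + b * x))) / 4 by rewrite /a; field.
have -> : a ^+ 2 / (4 * s) =
    expR (- (n%:R * (b ^+ 2 + 2 * b * x - (b - x) ^+ 2))) / (16 * n.+1%:R).
  rewrite /a /s pow2_expR -expRM_natl.
  have -> : expR (- (n%:R * (b ^+ 2 + 2 * b * x - (b - x) ^+ 2))) =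
    expR (n%:R * (ln 2 - (b ^+ 2 / 2 + b * x))) ^+ 2 *
    (expR (2%:R * (n%:R * ln 2)))^-1 * (expR (- (n%:R * (b - x) ^+ 2)))^-1.
    by rewrite -!expRN -expRM_natl -!expRD; congr expR; field.
  have n1 : n.+1%:R != 0 :> R by rewrite pnatr_eq0.
  have := expR_gt0 (2%:R * (n%:R * ln 2) : R).
  have := expR_gt0 (- (n%:R * (b - x) ^+ 2)).
  move: n1 (expR _) (expR _) (expR _) => + X Y Z /lt0r_neq0 Z0 /lt0r_neq0 Y0.
  move: n.+1%:R => m m0; field; by rewrite m0 Z0 Y0.
apply => //.
- exact: measurable_card_level_set.
- apply: le_trans (card_level_set_first_moment n_gt0 mu_gauss b0 (ltW x0)).
  have -> : a = expR (n%:R * ln 2) * (expR (- (n%:R * (b ^+ 2 / 2 + b * x))) * (1 / 2)).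
    by rewrite /a mulrBr expRD mul1r mulrA.
  rewrite lee_fin pow2_expR ler_wpM2l ?expR_ge0 // ler_wpM2l ?expR_ge0 //; lra.
- exact: (@card_level_set_second_moment k).
Qed.

(** Union bound over the pairs at a forbidden distance: when two energies are
    nearly independent, the cost of both being high exceeds the entropy
    [ln 2 + k] of such pairs. *)
Lemma not_OGP_prob (k nu1 h : R) : 0 < k -> k ^+ 2 / 4 <= 1 / 2 -> 0 <= h ->
  nu1 <= 1 / 2 ->
  (mu [set y | ~ OGP nu1 (k ^+ 2 / 4) (level_set h y)] <=
   (expR (n%:R * (ln 2 + k - h ^+ 2 / (1 + (1 - 2 * nu1) ^+ p))))%:E)%E.
Proof.
move=> k0 k2 h0 nu1h; set nu2 := k ^+ 2 / 4; set r := (1 - 2 * nu1) ^+ p.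
set A := (X in mu X).
have mA : measurable A by exact: (measurable_level_set_prop h (fun A => ~ OGP nu1 nu2 A)).
pose bad (st : cube n * cube n) :=
  (nu1 * n%:R < (hamming st.1 st.2)%:R) && ((hamming st.1 st.2)%:R < nu2 * n%:R).
pose E (st : cube n * cube n) := ham_ge (p := p) st.1 h `&` ham_ge st.2 h.
have mE st : measurable (E st) by apply: measurableI; exact: measurable_ham_ge.
have := @markov_ge0 _ _ _ mu (fun y => \sum_(st | bad st) \1_(E st) y) 1 A
  (measurable_sum_indic bad mE) mA.
move=> /(_ (fun=> sumr_ge0 _ (fun _ _ => ler0n _ _)) ler01) markov.
rewrite -[leLHS]mul1e; apply: (le_trans (markov _)).
  move=> y /= /existsNP[s] /existsNP[t] /not_implyP[hs] /not_implyP[ht] /not_orP[h1 h2].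
  have bst : bad (s, t) by rewrite /bad /= !ltNge; apply/andP; split; apply/negP.
  rewrite (bigD1 (s, t)) //= indicE mem_set; last first.
    by split; rewrite /ham_ge /= -in_level_set.
  by rewrite lerDl sumr_ge0.
rewrite integral_sum_indic //.
pose c : R := expR (- (n%:R * h ^+ 2 / (1 + r))).
apply: (@le_trans _ _ (\sum_(st | bad st) c%:E)%E).
  apply: lee_sum => -[s t] /andP[/= h1 h2].
  apply: (ham_pair_tail n_gt0 mu_gauss) => //; first by rewrite /r exprn_ge0 //; lra.
  have o1 : overlap R s t <= 1 - 2 * nu1.
    move: h1; rewrite -ltr_pdivlMr // /overlap -mulrA; lra.
  have o0 : 0 <= overlap R s t.
    move: h2; rewrite -ltr_pdivrMr // /overlap -mulrA /nu2; lra.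
  by rewrite lerXn2r // nnegrE; lra.
rewrite sumEFin lee_fin.
rewrite -(pair_big_dep xpredT (fun s t => bad (s, t)) (fun _ _ => c)) /=.
have -> : expR (n%:R * (ln 2 + k - h ^+ 2 / (1 + r))) =
    \sum_(s : cube n) expR (k * n%:R) * c.
  rewrite sumr_const -[RHS]mulr_natl card_cubeE pow2_expR /c -!expRD.
  by congr expR; ring.
apply: ler_sum => s _; rewrite sumr_const -[leLHS]mulr_natl.
rewrite ler_wpM2r ?expR_ge0 //; apply: le_trans (card_ball s k0).
rewrite ler_nat; apply: subset_leq_card; apply/fintype.subsetP => t.
by rewrite !inE => /andP[_ /ltW].
Qed.

(** [card_level_set_many] at the level [b - x], amplified by concentration to the
    lower level [h0]. *)
Lemma level_set_lower_tail (k b x h0 : R) :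
  0 < k -> k ^+ 2 <= 2 -> 0 < x -> x <= b -> h0 <= b - x ->
  (b - x) ^+ 2 <= 2 * ln 2 -> k + (b - x) ^+ 2 / 2 <= ln 2 ->
  (2 <= p)%N -> (1 - k ^+ 2 / 2) ^+ (p - 2) <= 1 / 16 ->
  2 * expR (- (n%:R * x ^+ 2 / 2)) <= 1 / 2 ->
  (mu [set y | (#|level_set h0 y|%:R < expR (n%:R * (ln 2 - (b ^+ 2 / 2 + b * x))) / 4)%R] <=
   (16 * n.+1%:R * expR (- (n%:R * ((b - x - h0) ^+ 2 / 4 -
       (b ^+ 2 + 2 * b * x - (b - x) ^+ 2)))))%:E)%E.
Proof.
move=> k0 k2 x0 xb hb h2 kh p2 hp nx.
have many := card_level_set_many k0 k2 x0 xb h2 kh p2 hp nx.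
have conc := level_sets_concentration n_gt0 mu_gauss
  (expR (n%:R * (ln 2 - (b ^+ 2 / 2 + b * x))) / 4) hb.
set B := (X in mu X).
set D := b ^+ 2 + 2 * b * x - (b - x) ^+ 2 in many *.
have c0 : 0 < expR (- (n%:R * D)) / (16 * n.+1%:R).
  by rewrite divr_gt0 ?expR_gt0 // mulr_gt0 // ltr0n.
rewrite -(@lee_pmul2l _ (expR (- (n%:R * D)) / (16 * n.+1%:R))%:E) ?lte_fin //.
apply: (@le_trans _ _ (expR (- (n%:R * (b - x - h0) ^+ 2 / 4)))%:E).
  by apply: le_trans conc; rewrite lee_wpmul2r.
rewrite -EFinM lee_fin; apply: eq_ler.
rewrite mulrACA -[X in _ = X * _ * _]mul1r.
have -> : - (n%:R * (b - x - h0) ^+ 2 / 4) =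
   - (n%:R * D) + - (n%:R * ((b - x - h0) ^+ 2 / 4 - D)) by field.
rewrite expRD; field.
by have := ler0n R n; lra.
Qed.

End second_moment.

(** * Clusterings *)

Section clustering.
Variables (R : realType) (n : nat).
Implicit Types (s t u : cube n) (A C : {set cube n}) (Cl : {set {set cube n}}).

Lemma hammingss s : hamming s s = 0%N.
Proof. by rewrite hamming_sum big1 // => i _; rewrite eqxx. Qed.

Lemma hammingC s t : hamming s t = hamming t s.
Proof. by rewrite !hamming_sum; apply: eq_bigr => i _; rewrite eq_sym. Qed.

Lemma hamming_triangle s t u : (hamming s u <= hamming s t + hamming t u)%N.
Proof.
rewrite !hamming_sum -big_split /=; apply: leq_sum => i _.
by case: (s i); case: (t i); case: (u i).
Qed.

Lemma OGP_sub (nu1 nu2 : R) A A' : A' \subset A -> OGP nu1 nu2 A -> OGP nu1 nu2 A'.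
Proof. by move=> /fintype.subsetP sAA og s t /sAA sA /sAA tA; exact: og. Qed.

(** Under the overlap gap property, being within distance [nu1 * n] is an
    equivalence relation, by the triangle inequality and [nu1 < nu2 / 2]. *)
Lemma OGP_clustering (nu1 nu2 : R) A : (0 < n)%N -> 0 <= nu1 < nu2 / 2 ->
  OGP nu1 nu2 A -> exists Cl, unique (clustering nu1 nu2 A) Cl.
Proof.
move=> n_gt0 /andP[nu10 nu12] og.
have n0 : 0 < n%:R :> R by rewrite ltr0n.
have n12 : 2 * (nu1 * n%:R) < nu2 * n%:R by nra.
have n10 : 0 <= nu1 * n%:R by rewrite mulr_ge0.
pose E s t := (hamming s t)%:R <= nu1 * n%:R.
have Esym s t : E s t = E t s by rewrite /E hammingC.
have Etrans s t u : s \in A -> u \in A -> E s t -> E t u -> E s u.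
  move=> sA uA Est Etu; have [//|h] := og s u sA uA.
  have := hamming_triangle s t u; rewrite -(ler_nat R) natrD.
  by rewrite /E in Est Etu *; lra.
have eqE : {in A & &, equivalence_rel E}.
  move=> s t u sA tA uA; split; first by rewrite /E hammingss.
  move=> Est; apply/idP/idP; last exact: Etrans.
  by apply: Etrans => //; rewrite Esym.
have partE := equivalence_partitionP eqE.
exists (equivalence_partition E A); split.
  split=> //.
    move=> C s t /imsetP[v vA ->]; rewrite !inE => /andP[sA Evs] /andP[tA Evt].
    by apply: (Etrans s v t) => //; rewrite Esym.
  move=> C D s t CP DP CD sC tD.
  have [/eqP cov tiP _] := and3P partE.
  have sA : s \in A by rewrite -cov; apply/finset.bigcupP; exists C.
  have tA : t \in A by rewrite -cov; apply/finset.bigcupP; exists D.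
  have [Est|//] := og s t sA tA; case/eqP: CD.
  rewrite -(def_pblock tiP CP sC) -(def_pblock tiP DP tD).
  apply/eqP; rewrite eq_pblock ?cov // pblock_equivalence_partition //.
(* Any clustering has the same block relation, hence the same blocks. *)
move=> Cl [partCl cl1 cl2]; rewrite -(equivalence_partition_pblock partCl).
have [/eqP cov tiP _] := and3P partCl.
apply: eq_in_imset => s sA; apply/setP => t; rewrite !inE.
case: (boolP (t \in A)) => //= tA.
have sP : finset.pblock Cl s \in Cl by rewrite pblock_mem // cov.
have tP : finset.pblock Cl t \in Cl by rewrite pblock_mem // cov.
have ss : s \in finset.pblock Cl s by rewrite mem_pblock cov.
have tt : t \in finset.pblock Cl t by rewrite mem_pblock cov.
apply/idP/idP => [Est|ts]; last exact: (cl1 _ _ _ sP).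
rewrite -eq_pblock ?cov //; apply/negPn/negP => neq.
have := cl2 _ _ _ _ sP tP neq ss tt; rewrite /E in Est; lra.
Qed.

(** A cluster lies in a ball around any of its points. *)
Lemma cluster_card_le (nu1 nu2 k : R) A Cl : 0 < k -> nu1 <= k ^+ 2 / 4 ->
  clustering nu1 nu2 A Cl -> (\max_(C in Cl) #|C|)%:R <= expR (k * n%:R).
Proof.
move=> k0 nuk [_ cl1 _].
elim/big_ind: _ => [|a b ha hb|C CCl]; first by rewrite expR_ge0.
  by rewrite /maxn; case: ifP.
have [->|[s sC]] := set_0Vmem C; first by rewrite cards0 expR_ge0.
apply: le_trans (card_ball s k0); rewrite ler_nat; apply: subset_leq_card.
apply/fintype.subsetP => t tC; rewrite inE.
by apply: le_trans (cl1 _ _ _ CCl sC tC) _; rewrite ler_wpM2r.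
Qed.

Lemma card_clusters_ge (nu1 nu2 c1 c2 : R) A Cl :
  shattered nu1 nu2 c1 c2 A Cl -> 2 `^ ((c1 - c2) * n%:R) <= #|Cl|%:R :> R.
Proof.
move=> [[[partCl _ _] _] leA maxC].
have c20 : 0 < 2 `^ (c2 * n%:R) :> R by rewrite powR_gt0.
rewrite mulrBl powRB; last by rewrite pnatr_eq0 implybT.
rewrite ler_pdivrMr //; apply: (le_trans leA).
apply: (@le_trans _ _ (#|Cl|%:R * (\max_(C in Cl) #|C|)%:R)); last by rewrite ler_wpM2l.
rewrite (card_partition partCl) -natrM ler_nat -sum_nat_const.
by apply: leq_sum => C CCl; exact: (leq_bigmax_cond _ CCl).
Qed.

End clustering.

(** * Asymptotic estimates *)

Section asymptotics.
Variable R : realType.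

Lemma expR_dominates_linear (c : R) : 0 < c ->
  \forall n \near \oo, 16 * n%:R + 25 <= expR (n%:R * c).
Proof.
move=> c0; near=> n.
have h1 : 1 <= n%:R :> R by near: n; exact: nbhs_infty_ger.
have h2 : 82 / c ^+ 2 <= n%:R by near: n; exact: nbhs_infty_ger.
have nc0 : 0 <= n%:R * c by rewrite mulr_ge0 // ltW.
apply: le_trans (expR_ge1Dxn 1 nc0).
have : 82 <= n%:R * c ^+ 2 by rewrite -ler_pdivrMr ?exprn_gt0.
rewrite exprMn (_ : 2`!%:R = 2) //; move: (c ^+ 2) => d; rewrite expr2; nra.
Unshelve. all: by end_near. Qed.

Lemma expr_eventually_le (r e : R) : 0 <= r < 1 -> 0 < e ->
  exists N, forall m, (N <= m)%N -> r ^+ m <= e.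
Proof.
move=> /andP[r0 r1] e0.
have : (GRing.exp r : R^nat) @ \oo --> 0 by apply: cvg_expr; rewrite ger0_norm.
move=> /cvgrPdist_le /(_ e e0) [N _ HN]; exists N => m Nm.
have := HN m Nm; rewrite /= sub0r normrN ger0_norm ?exprn_ge0 //.
Qed.

Lemma pow2E (c : R) (n : nat) : 2 `^ (c * n%:R) = expR (n%:R * (c * ln 2)).
Proof. by rewrite /powR pnatr_eq0 /=; congr expR; ring. Qed.

End asymptotics.

Lemma probability_ge_union3 (R : realType) (d : measure_display)
    (T : measurableType d) (mu : probability T R) (G B1 B2 B3 : set T) (b1 b2 b3 : R) :
  measurable G -> measurable B1 -> measurable B2 -> measurable B3 ->
  ~` G `<=` B1 `|` B2 `|` B3 ->
  (mu B1 <= b1%:E)%E -> (mu B2 <= b2%:E)%E -> (mu B3 <= b3%:E)%E ->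
  ((1 - (b1 + b2 + b3))%:E <= mu G)%E.
Proof.
move=> mG m1 m2 m3 GB h1 h2 h3.
have h : (mu (~` G) <= (b1 + b2 + b3)%:E)%E.
  apply: (@le_trans _ _ (mu (B1 `|` B2 `|` B3))).
    apply: le_measure => //; rewrite inE; first exact: measurableC.
    by apply: measurableU => //; exact: measurableU.
  apply: le_trans (measureU2 _ _ _) _ => //; first exact: measurableU.
  rewrite EFinD leeD // EFinD.
  by apply: le_trans (measureU2 _ _ _) _ => //; exact: leeD.
rewrite -[G]setCK probability_setC; last exact: measurableC.
by rewrite EFinB leeB.
Qed.

(** * Overlap gap property and abundance with high probability *)

(** The joint law of an independent standard normal family: events about the
    family can be computed under a law satisfying [iid_gauss]. *)
Lemma iid_standard_normal_law (R : realType) (d : measure_display)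
    (T : measurableType d) (P : probability T R) (I : finType)
    (J : I -> {RV P >-> R}) : iid_standard_normal J ->
  exists2 mu : probability (rvect R I) R, iid_gauss mu &
    forall A : set (rvect R I), measurable A ->
      measurable [set w | A (fun i => J i w)] /\
      P [set w | A (fun i => J i w)] = mu A.
Proof.
move=> [indep law].
pose X (w : T) : rvect R I := fun i => J i w.
have mX : measurable_fun setT X.
  by apply: measurable_rvectP => i; exact: measurable_funP.
pose Xf : {mfun T >-> rvect R I} := HB.pack X (isMeasurableFun.Build _ _ _ _ _ mX).
exists (distribution P Xf); last first.
  by move=> A mA; split => //; have := mX measurableT A mA; rewrite setTI.
move=> B mB.
transitivity (P [set w | forall i, i \in [set: I]%SET -> B i (J i w)]).
  congr (P _); apply/seteqP; split => w /= h i; last by apply: h; rewrite inE.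
  by move=> _; exact: h.
rewrite (indep _ _ mB); apply: eq_big => [i|i _]; first by rewrite inE.
by rewrite -(law i (B i) (mB i)).
Qed.

Section good_event.
Variables (R : realType) (p n : nat).
Local Notation I := {ffun 'I_p -> 'I_n}.
Local Notation rvect := (rvect R I).
Variable mu : probability rvect R.
Hypothesis mu_gauss : iid_gauss mu.
Hypothesis n_gt0 : (0 < n)%N.

(** The union bound for fixed [n]: the overlap gap property holds at level [h0],
    at least some number [K] of configurations are above [h0], and fewer than
    [K / 2] are above [h1].
    Each of the three exceptional events has exponential rate at least [C]; the
    factor [16 * n + 25] collects their prefactors. *)
Lemma good_level_sets (k nu1 h0 b x h1 c C : R) :
  0 < k -> k ^+ 2 <= 2 -> nu1 <= 1 / 2 -> 0 < x -> x <= b ->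
  0 <= h0 -> h0 <= b - x -> 0 <= h1 ->
  (b - x) ^+ 2 <= 2 * ln 2 -> k + (b - x) ^+ 2 / 2 <= ln 2 ->
  (2 <= p)%N -> (1 - k ^+ 2 / 2) ^+ (p - 2) <= 1 / 16 ->
  C <= h0 ^+ 2 / (1 + (1 - 2 * nu1) ^+ p) - ln 2 - k ->
  C <= (b - x - h0) ^+ 2 / 4 - (b ^+ 2 + 2 * b * x - (b - x) ^+ 2) ->
  C <= h1 ^+ 2 / 2 - (b ^+ 2 / 2 + b * x) ->
  c * ln 2 + C <= ln 2 - (b ^+ 2 / 2 + b * x) ->
  16 * n%:R + 25 <= expR (n%:R * (C / 2)) ->
  2 * expR (- (n%:R * x ^+ 2 / 2)) <= 1 / 2 ->
  ((1 - expR (- (C / 2 * n%:R)))%:E <=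
   mu [set y | OGP nu1 (k ^+ 2 / 4) (level_set h0 y) /\
     (2 `^ (c * n%:R) <= #|level_set h0 y :\: level_set h1 y|%:R :> R)%R])%E.
Proof.
move=> k0 k2 nu1h x0 xb h00 h0b h10 h2 kh p2 hp C1 C2 C3 cC nC nx.
have n0 : 0 < n%:R :> R by rewrite ltr0n.
have C0 : 0 < C.
  have : 1 < expR (n%:R * (C / 2)) by have := ltW n0; lra.
  by rewrite expR_gt1 pmulr_rgt0 // => h; lra.
set G := (X in mu X).
pose K : R := expR (n%:R * (ln 2 - (b ^+ 2 / 2 + b * x))) / 4.
have K0 : 0 < K by rewrite divr_gt0 ?expR_gt0.
have e0 := expR_gt0 (- (n%:R * C)).
have le_expC v : C <= v -> expR (- (n%:R * v)) <= expR (- (n%:R * C)).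
  by move=> Cv; rewrite ler_expR lerN2 ler_wpM2l // ltW.
have B1 : (mu [set y | ~ OGP nu1 (k ^+ 2 / 4) (level_set h0 y)] <=
    (expR (- (n%:R * C)))%:E)%E.
  apply: (le_trans (not_OGP_prob mu_gauss n_gt0 k0 _ h00 nu1h)); first by lra.
  rewrite lee_fin; apply: le_trans (le_expC _ C1); apply: eq_ler.
  by congr expR; ring.
have B2 : (mu [set y | (#|level_set h0 y|%:R < K)%R] <=
    (16 * n.+1%:R * expR (- (n%:R * C)))%:E)%E.
  apply: (le_trans (level_set_lower_tail mu_gauss n_gt0 k0 k2 x0 xb h0b h2 kh p2 hp nx)).
  by rewrite lee_fin ler_wpM2l ?le_expC // mulr_ge0.
have B3 : (mu [set y | (K / 2 <= #|level_set h1 y|%:R)%R] <=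
    (8 * expR (- (n%:R * C)))%:E)%E.
  have K20 : 0 < K / 2 by rewrite divr_gt0.
  apply: (le_trans (card_level_set_markov n_gt0 mu_gauss h10 K20)).
  rewrite lee_fin ler_pdivrMr //.
  apply: (@le_trans _ _ (8 * expR (- (n%:R * (h1 ^+ 2 / 2 - (b ^+ 2 / 2 + b * x)))) * (K / 2))).
    apply: eq_ler; rewrite /K pow2_expR -expRD.
    have -> : n%:R * ln 2 + - (n%:R * h1 ^+ 2 / 2) =
      - (n%:R * (h1 ^+ 2 / 2 - (b ^+ 2 / 2 + b * x))) +
      n%:R * (ln 2 - (b ^+ 2 / 2 + b * x)) by field.
    by rewrite expRD; field.
  by rewrite ler_wpM2r ?(ltW K20) // ler_wpM2l // le_expC.
have Kc : 2 `^ (c * n%:R) <= K / 2.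
  have -> : K / 2 = expR (n%:R * (ln 2 - (b ^+ 2 / 2 + b * x))) / 8 by rewrite /K; field.
  rewrite ler_pdivlMr // pow2E.
  apply: (@le_trans _ _ (expR (n%:R * (c * ln 2)) * expR (n%:R * (C / 2)))).
    by rewrite ler_wpM2l ?expR_ge0 //; have := ltW n0; lra.
  by rewrite -expRD ler_expR -mulrDr ler_wpM2l //; lra.
have mG : measurable G.
  exact: (measurable_level_sets2 h0 h1 (fun A B => OGP nu1 (k ^+ 2 / 4) A /\
    (2 `^ (c * n%:R) <= #|A :\: B|%:R :> R))).
apply: le_trans (probability_ge_union3 mG _ _ _ _ B1 B2 B3).
- rewrite lee_fin lerD2l lerN2.
  have -> : expR (- (n%:R * C)) + 16 * n.+1%:R * expR (- (n%:R * C)) + 8 * expR (- (n%:R * C)) =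
     (16 * n%:R + 25) * expR (- (n%:R * C)) by rewrite -(natr1 n); ring.
  apply: (@le_trans _ _ (expR (n%:R * (C / 2)) * expR (- (n%:R * C)))).
    by rewrite ler_wpM2r // ltW.
  by rewrite -expRD ler_expR; apply: eq_ler; field.
- exact: (measurable_level_set_prop h0 (fun A => ~ OGP nu1 (k ^+ 2 / 4) A)).
- exact: (measurable_level_set_prop h0 (fun A => #|A|%:R < K)).
- exact: (measurable_level_set_prop h1 (fun A => K / 2 <= #|A|%:R)).
move=> y /=; rewrite /G /= => /not_andP[nog|small]; first by left; left.
case: (ltP #|level_set h0 y|%:R K) => [lt|ge]; first by left; right.
right => /=; rewrite leNgt; apply/negP => lt; apply: small.
apply: (le_trans Kc); rewrite -(@lerD2r _ #|level_set h1 y|%:R) -natrD.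
apply: (@le_trans _ _ #|level_set h0 y|%:R); first by lra.
rewrite ler_nat -(cardsID (level_set h1 y) (level_set h0 y)) addnC leq_add2l.
by apply: subset_leq_card; apply: subsetIr.
Qed.

End good_event.

(** A level [h] slightly above [h0] and a width [x] small enough for all the
    exponential rates of [good_level_sets] to be positive. *)
Lemma choose_levels (R : realType) (h0 h1 ht c g : R) :
  0 <= h0 -> h0 < h1 -> h0 < ht -> 0 < c -> 0 < g ->
  exists h x C : R,
    [/\ [/\ h0 <= h, h <= ht, 0 < x & 0 < C],
      (h + x) ^+ 2 + 2 * (h + x) * x - h ^+ 2 <= c,
      [/\ C <= g & C <= c / 2],
      C <= (h - h0) ^+ 2 / 4 - ((h + x) ^+ 2 + 2 * (h + x) * x - h ^+ 2) &
      C <= h1 ^+ 2 / 2 - ((h + x) ^+ 2 / 2 + (h + x) * x)].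
Proof.
move=> h00 h01 h0t c0 g0.
have [h [h0h hh1 hht]] : exists h, [/\ h0 < h, h < h1 & h < ht].
  by case: (lerP h1 ht) => H; [exists ((h0 + h1) / 2)|exists ((h0 + ht) / 2)]; split; lra.
pose D1 := (h - h0) ^+ 2; pose D2 := h1 ^+ 2 - h ^+ 2.
have D10 : 0 < D1 by rewrite exprn_gt0 // subr_gt0.
have D20 : 0 < D2 by rewrite /D2 subr_sqr mulr_gt0; lra.
have [m [m0 m1 mD1 mD2 mc]] : exists m, [/\ 0 < m, m <= 1, m <= D1 / 8, m <= D2 / 2 & m <= c].
  exists (Num.min 1 (Num.min (D1 / 8) (Num.min (D2 / 2) c))).
  by split; rewrite ?lt_min ?ge_min ?lexx ?orbT // ltr01 c0 !divr_gt0.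
have den : 0 < 4 * h + 3 by lra.
(* For x <= 1 the loss (h + x)^2 + 2 (h + x) x - h^2 = 4 h x + 3 x^2 is at
   most (4 h + 3) x. *)
pose x : R := m / (4 * h + 3).
have x0 : 0 < x by rewrite divr_gt0.
have xm : x * (4 * h + 3) = m by rewrite /x divfK // gt_eqF.
have x1 : x <= 1 by rewrite ler_pdivrMr //; lra.
have Dm : (h + x) ^+ 2 + 2 * (h + x) * x - h ^+ 2 <= m.
  by rewrite -xm !expr2; nra.
have [C [C0 Cg Cc C1 C2]] : exists C, [/\ 0 < C, C <= g, C <= c / 2, C <= D1 / 8 & C <= D2 / 4].
  exists (Num.min g (Num.min (c / 2) (Num.min (D1 / 8) (D2 / 4)))).
  by split; rewrite ?lt_min ?ge_min ?lexx ?orbT // g0 !divr_gt0.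
exists h, x, C; split => //.
- by split=> //; apply: ltW.
- exact: le_trans mc.
- by rewrite -/D1; lra.
- by rewrite /D2 in C2 mD2; lra.
Qed.

(** [choose_levels] in the units of the model: the levels are [x] and [x'] times
    the ground state energy [Num.sqrt (2 * ln 2)] of independent energies. *)
Lemma choose_parameters (R : realType) (x x' y0 k e : R) :
  0 < x -> x < x' -> x < y0 -> y0 ^+ 2 < 1 -> 0 < 2 * x ^+ 2 - 1 <= 1 ->
  k <= (1 - y0 ^+ 2) / 4 * ln 2 -> k <= (2 * x ^+ 2 - 1) * ln 2 / 4 ->
  0 <= e <= (2 * x ^+ 2 - 1) / 4 ->
  let s := Num.sqrt (2 * ln 2) in
  exists h xi C : R,
    [/\ [/\ 0 < xi, 0 < C, 0 <= x * s, x * s <= h & 0 <= x' * s],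
       h ^+ 2 <= 2 * ln 2 /\ k + h ^+ 2 / 2 <= ln 2,
       C <= (x * s) ^+ 2 / (1 + e) - ln 2 - k,
       C <= (h - x * s) ^+ 2 / 4 - ((h + xi) ^+ 2 + 2 * (h + xi) * xi - h ^+ 2) /\
       C <= (x' * s) ^+ 2 / 2 - ((h + xi) ^+ 2 / 2 + (h + xi) * xi) &
       (1 - y0 ^+ 2) / 2 * ln 2 + C <= ln 2 - ((h + xi) ^+ 2 / 2 + (h + xi) * xi)].
Proof.
move=> x0 xx' xy y1 /andP[q0 q1] kc kq /andP[e0 e1] s.
set L : R := ln 2 in s kc kq *.
have L0 : 0 < L by rewrite ln_gt0 // ltr1n.
have s0 : 0 < s by rewrite sqrtr_gt0 mulr_gt0.
have s2 : s ^+ 2 = 2 * L by rewrite sqr_sqrtr // mulr_ge0 // ltW.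
have h00 : 0 <= x * s by rewrite mulr_ge0 // ltW.
have h01 : x * s < x' * s by rewrite ltr_pM2r.
have h0t : x * s < y0 * s by rewrite ltr_pM2r.
have c1L : 0 < (1 - y0 ^+ 2) / 2 * L by rewrite mulr_gt0 // divr_gt0 // subr_gt0.
have qL : 0 < (2 * x ^+ 2 - 1) * L / 4 by rewrite divr_gt0 // mulr_gt0.
have yL : y0 ^+ 2 * L <= L by apply: ler_piMl; exact: ltW.
have hq : 1 + (2 * x ^+ 2 - 1) / 2 <= 2 * x ^+ 2 / (1 + e).
  rewrite ler_pdivlMr; last by apply: ltr_wpDr.
  have := ler_wpM2l (ltW q0) e1; have := ler_wpM2l (ltW q0) q1.
  by clear -q0 e1; lra.
have {}hq := ler_wpM2r (ltW L0) hq.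
have [h [xi [C [[h0h hht xi0 C0] Dc [Cg Cc] C2 C3]]]] := choose_levels h00 h01 h0t c1L qL.
have h_0 : 0 <= h by apply: le_trans h0h.
have hh : h ^+ 2 <= y0 ^+ 2 * (2 * L).
  by rewrite -s2 -exprMn lerXn2r // nnegrE // (le_trans h_0).
exists h, xi, C; split => //.
- by split => //; rewrite (le_trans h00) // ltW.
- by clear -hh kc yL; split; lra.
- rewrite exprMn s2.
  have -> : x ^+ 2 * (2 * L) / (1 + e) = 2 * x ^+ 2 / (1 + e) * L by ring.
  by clear -hq Cg kq; lra.
- by clear -Dc Cc hh; lra.
Qed.

(** With high probability every property [Q] that follows from the overlap gap
    property and the abundance of configurations between the two levels holds. *)
Lemma good_levels_whp (R : realType) (p : nat) (k nu1 h0 h1 h x c C : R)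
    (d : nat -> measure_display) (T : forall n, measurableType (d n))
    (P : forall n, probability (T n) R)
    (J : forall n, {ffun 'I_p -> 'I_n} -> {RV (P n) >-> R}) :
  (forall n, iid_standard_normal (J n)) ->
  0 < k -> k ^+ 2 <= 2 -> nu1 <= 1 / 2 ->
  [/\ 0 < x, 0 < C, 0 <= h0, h0 <= h & 0 <= h1] ->
  h ^+ 2 <= 2 * ln 2 /\ k + h ^+ 2 / 2 <= ln 2 ->
  (2 <= p)%N -> (1 - k ^+ 2 / 2) ^+ (p - 2) <= 1 / 16 ->
  C <= h0 ^+ 2 / (1 + (1 - 2 * nu1) ^+ p) - ln 2 - k ->
  C <= (h - h0) ^+ 2 / 4 - ((h + x) ^+ 2 + 2 * (h + x) * x - h ^+ 2) /\
  C <= h1 ^+ 2 / 2 - ((h + x) ^+ 2 / 2 + (h + x) * x) ->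
  c * ln 2 + C <= ln 2 - ((h + x) ^+ 2 / 2 + (h + x) * x) ->
  exists2 C' : R, 0 < C' & \forall n \near \oo, (0 < n)%N /\
    forall Q : {set cube n} -> {set cube n} -> Prop,
    (forall A B, OGP nu1 (k ^+ 2 / 4) A -> 2 `^ (c * n%:R) <= #|A :\: B|%:R :> R -> Q A B) ->
    ((1 - expR (- (C' * n%:R)))%:E <=
     P n [set w | Q (level_set h0 (fun i => J n i w)) (level_set h1 (fun i => J n i w))])%E.
Proof.
move=> iidJ k0 k2 nu1h [x0 C0 h00 h0h h10] [h2 kh] p2 hp C1 [C2 C3] cC.
exists (C / 2); first by rewrite divr_gt0.
have C20 : 0 < C / 2 by rewrite divr_gt0.
have x20 : 0 < x ^+ 2 / 2 by rewrite divr_gt0 // exprn_gt0.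
near=> n.
have n_gt0 : (0 < n)%N by near: n; exists 1%N.
have nC : 16 * n%:R + 25 <= expR (n%:R * (C / 2)).
  by near: n; exact: expR_dominates_linear.
have nx : 16 * n%:R + 25 <= expR (n%:R * (x ^+ 2 / 2)).
  by near: n; exact: expR_dominates_linear.
split => // Q HQ.
have [mu mu_gauss transfer] := iid_standard_normal_law (iidJ n).
pose G (A B : {set cube n}) :=
  OGP nu1 (k ^+ 2 / 4) A /\ 2 `^ (c * n%:R) <= #|A :\: B|%:R :> R.
have ev (Q' : {set cube n} -> {set cube n} -> Prop) :=
  transfer _ (measurable_level_sets2 h0 h1 Q').
have [mQ _] := ev Q; have [mG PG] := ev G.
apply: (@le_trans _ _ (P n [set w | G (level_set h0 (fun i => J n i w))
    (level_set h1 (fun i => J n i w))])); last first.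
  by apply: le_measure; rewrite ?inE // => w [og card]; exact: HQ.
rewrite [leRHS]PG.
have := @good_level_sets _ _ _ _ mu_gauss n_gt0 k nu1 h0 (h + x) x h1 c C.
rewrite addrK; apply => //.
- by rewrite lerDr (le_trans h00).
- rewrite expRN -mulrA ler_pdivrMr ?expR_gt0 //.
  by have := ler0n R n; clear -nx; lra.
Unshelve. all: by end_near. Qed.

(** Both hypotheses on [A] give a shattered clustering deterministically. *)
Lemma good_shattered (R : realType) (n : nat) (nu1 nu2 k c1 c2 : R)
    (A B : {set cube n}) :
  (0 < n)%N -> 0 <= nu1 < nu2 / 2 -> 0 < k -> nu1 <= k ^+ 2 / 4 -> k <= c2 * ln 2 ->
  A \subset B -> OGP nu1 nu2 B -> 2 `^ (c1 * n%:R) <= #|A|%:R :> R ->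
  exists Cl, shattered nu1 nu2 c1 c2 A Cl.
Proof.
move=> n_gt0 nu12 k0 nuk kc AB og cA.
have [Cl uCl] := OGP_clustering n_gt0 nu12 (OGP_sub AB og).
exists Cl; split => //; case: uCl => clCl _.
apply: (le_trans (cluster_card_le k0 nuk clCl)).
by rewrite pow2E ler_expR mulrC ler_wpM2l.
Qed.

Theorem theorem2p7 (R : realType) (eps : R)
    (heps : 0 < eps < 1 - 1 / Num.sqrt 2) :
  exists (Phat : nat) (nu1 nu2 c1 c2 : R),
    [/\ 0 < nu1 < nu2 / 2, nu2 / 2 < nu2 < 1, 0 < c2 < c1 &
      forall p : nat, (2 <= p)%N -> (Phat <= p)%N ->
      forall (d : nat -> measure_display) (T : forall n, measurableType (d n))
        (P : forall n, probability (T n) R)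
        (J : forall n, {ffun 'I_p -> 'I_n} -> {RV (P n) >-> R}),
      (forall n, iid_standard_normal (J n)) ->
      let S (e : R) (n : nat) (w : T n) : {set cube n} :=
        superlevel (fun i => J n i w) e in
      shattering nu1 nu2 c1 c2 P (S eps) /\
      forall eps' : R, 0 < eps' < eps ->
        shattering nu1 nu2 c1 c2 P (fun n w => S eps n w :\: S eps' n w)].
Proof.
have /andP[eps0 eps1] := heps.
pose L : R := ln 2.
have L0 : 0 < L by rewrite ln_gt0 // ltr1n.
have L1 : L <= 1 by exact: ln2_le1.
pose x : R := 1 - eps.
have x_sqrt : (Num.sqrt 2)^-1 < x by move: eps1; rewrite /x mul1r; lra.
have x0 : 0 < x by apply: lt_trans x_sqrt; rewrite invr_gt0 sqrtr_gt0.
have x2 : 1 / 2 < x ^+ 2.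
  have : (Num.sqrt 2)^-1 ^+ 2 < x ^+ 2.
    by rewrite ltrXn2r // ?nnegrE ?invr_ge0 ?sqrtr_ge0 // ltW.
  by rewrite exprVn sqr_sqrtr // mul1r.
have x1 : x < 1 by rewrite /x; lra.
pose q : R := 2 * x ^+ 2 - 1.
have q0 : 0 < q by rewrite /q; lra.
have q1 : q <= 1.
  by have : x ^+ 2 <= 1; [rewrite expr_le1 // ltW|rewrite /q; lra].
(* Levels between x and y0 are used to produce many configurations; c1 does
   not depend on eps'. *)
pose y0 : R := (1 + x) / 2.
have xy0 : x < y0 by rewrite /y0; lra.
have y01 : y0 ^+ 2 < 1 by rewrite expr_lt1 // /y0; lra.
pose c1 : R := (1 - y0 ^+ 2) / 2.
have c10 : 0 < c1 by rewrite /c1; lra.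
have c11 : c1 <= 1 by rewrite /c1; have := sqr_ge0 y0; lra.
pose c2 : R := c1 / 2.
have [k [k0 kc kq]] : exists k, [/\ 0 < k, k <= (1 - y0 ^+ 2) / 4 * L & k <= q * L / 4].
  exists (Num.min ((1 - y0 ^+ 2) / 4 * L) (q * L / 4)).
  have cL0 : 0 < (1 - y0 ^+ 2) / 4 * L by rewrite mulr_gt0 // divr_gt0 // subr_gt0.
  have qL0 : 0 < q * L / 4 by rewrite divr_gt0 // mulr_gt0.
  by split; rewrite ?lt_min ?ge_min ?lexx ?orbT // cL0.
have kc2 : k <= c2 * L by rewrite (_ : c2 = (1 - y0 ^+ 2) / 4) // /c2 /c1; field.
have k1 : k <= 1 / 2.
  by apply: (le_trans kc2); have := ler_wpM2l (ltW c10) L1; rewrite /c2; lra.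
have k2 : k ^+ 2 <= 1 / 4.
  by have := ler_pM (ltW k0) (ltW k0) k1 k1; rewrite expr2; lra.
have k20 : 0 < k ^+ 2 by rewrite exprn_gt0.
pose nu1 : R := k ^+ 2 / 16; pose nu2 : R := k ^+ 2 / 4.
have nu1h : nu1 <= 1 / 2 by rewrite /nu1; lra.
have nu12 : 0 <= nu1 < nu2 / 2 by rewrite /nu1 /nu2; apply/andP; split; lra.
have base0 : 0 <= 1 - 2 * nu1 by lra.
have base1 : 0 <= 1 - k ^+ 2 / 2 <= 1 - 2 * nu1 by rewrite /nu1; apply/andP; split; lra.
have k22 : k ^+ 2 <= 2 by lra.
have nuk : nu1 <= k ^+ 2 / 4 by rewrite /nu1; lra.
have c12 : 0 < c1 - c2 by rewrite /c2; lra.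
(* Any eps' < eps serves for S eps itself, which contains S eps :\: S eps'. *)
have eps2 : 0 < eps / 2 < eps by apply/andP; split; lra.
have qP : 0 < 2 * x ^+ 2 - 1 <= 1 by rewrite q0.
have [N HN] : exists N, forall m, (N <= m)%N ->
    (1 - 2 * nu1) ^+ m <= Num.min (q / 4) (1 / 16).
  apply: expr_eventually_le; first by rewrite /nu1; apply/andP; split; lra.
  by rewrite lt_min; apply/andP; split; lra.
exists (N + 2)%N, nu1, nu2, c1, c2; split.
- by rewrite /nu1 /nu2; apply/andP; split; lra.
- by rewrite /nu2; apply/andP; split; lra.
- by rewrite /c2; apply/andP; split; lra.
move=> p p2 Np d T P J iidJ S.
have hp : (1 - k ^+ 2 / 2) ^+ (p - 2) <= 1 / 16.
  have := HN (p - 2)%N; rewrite leq_subRL // addnC => /(_ Np).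
  rewrite le_min => /andP[_]; apply: le_trans.
  by case/andP: base1 => b0 b1; rewrite lerXn2r.
have eta : (1 - 2 * nu1) ^+ p <= q / 4.
  have := HN p; rewrite (leq_trans (leq_addr _ _) Np) => /(_ isT).
  by rewrite le_min => /andP[].
have etaP : 0 <= (1 - 2 * nu1) ^+ p <= q / 4 by rewrite eta andbT exprn_ge0.
have key (eps' : R) : 0 < eps' < eps -> exists2 C : R, 0 < C &
    \forall n \near \oo, (0 < n)%N /\
      forall Q : {set cube n} -> {set cube n} -> Prop,
      (forall A B, OGP nu1 nu2 A -> 2 `^ (c1 * n%:R) <= #|A :\: B|%:R :> R -> Q A B) ->
      ((1 - expR (- (C * n%:R)))%:E <= P n [set w | Q (S eps n w) (S eps' n w)])%E.
  move=> /andP[_ lt_eps].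
  have xx' : x < 1 - eps' by rewrite /x ltrD2l ltrN2.
  have [h [xi [C [pos hk C1 C2 C3]]]] :=
    choose_parameters x0 xx' xy0 y01 qP kc kq etaP.
  exact: (good_levels_whp iidJ k0 k22 nu1h pos hk p2 hp C1 C2 C3).
have clusters (A : forall n, T n -> {set cube n}) : exists2 C : R, 0 < C &
    \forall n \near \oo, forall w Cl,
      shattered nu1 nu2 c1 c2 (A n w) Cl -> 2 `^ (C * n%:R) <= #|Cl|%:R.
  exists (c1 - c2) => //.
  by near=> n; move=> w Cl; exact: card_clusters_ge.
split=> [|eps' heps']; split => //.
- have [C C0 HC] := key _ eps2; exists C => //.
  apply: filterS HC => n [n_gt0 H].
  by apply: (H (fun A _ => OGP nu1 nu2 A)).
- have [C C0 HC] := key _ eps2; exists C => //.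
  apply: filterS HC => n [n_gt0 H].
  apply: (H (fun A _ => exists Cl, shattered nu1 nu2 c1 c2 A Cl)) => A B og cA.
  apply: (good_shattered n_gt0 nu12 k0 nuk kc2 (fintype.subxx _) og).
  by apply: (le_trans cA); rewrite ler_nat subset_leq_card // subsetDl.
- have [C C0 HC] := key _ heps'; exists C => //.
  apply: filterS HC => n [n_gt0 H].
  apply: (H (fun A B => OGP nu1 nu2 (A :\: B))) => A B og cA.
  exact: OGP_sub (subsetDl _ _) og.
- have [C C0 HC] := key _ heps'; exists C => //.
  apply: filterS HC => n [n_gt0 H].
  apply: (H (fun A B => exists Cl, shattered nu1 nu2 c1 c2 (A :\: B) Cl)) => A B og cA.
  exact: (good_shattered n_gt0 nu12 k0 nuk kc2 (subsetDl _ _) og).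
Unshelve. all: by end_near. Qed.
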